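(* Let $\boldsymbol{X}=(X_1,\ldots,X_n)^\top\sim EC_n(\boldsymbol{\mu},\boldsymbol{\Sigma},g^{(n)})$ be an exchangeable random vector, where $g^{(n)}(x)=(1+x/\nu)^{-(\nu+n)/2}$ and $\nu>1$. Then the Gini mean difference is given by $$GMD_n=\frac{2}{\sqrt{\pi}}\,\sigma_1\,\frac{\sqrt{2\nu}\,\Gamma\!\left(\frac{\nu+1}{2}\right)}{(\nu-1)\,\Gamma\!\left(\frac{\nu}{2}\right)}\,\frac{1}{\binom{n}{2}}\sum_{1\leq i<j\leq n}\sqrt{1-\rho_{i,j}},$$ where $\mu_1=\mathbb{E}(X_1)$ and $\sigma_1^2=\mathrm{Var}(X_1)$.
   Context: The Gini mean difference of random variables $X_1,\ldots,X_n$ ($n\geq 2$) is $GMD_n=\frac{1}{\binom{n}{2}}\sum_{1\leq i<j\leq n}\mathbb{E}(|X_i-X_j|)$, provided the expectations exist. $\boldsymbol{X}\sim EC_n(\boldsymbol{\mu},\boldsymbol{\Sigma},g^{(n)})$ (elliptically contoured distribution) means that $\boldsymbol{X}$ has joint density $f(\boldsymbol{x})=k_n|\boldsymbol{\Sigma}|^{-1/2}g^{(n)}[(\boldsymbol{x}-\boldsymbol{\mu})^\top\boldsymbol{\Sigma}^{-1}(\boldsymbol{x}-\boldsymbol{\mu})]$, $\boldsymbol{x}\in\mathbb{R}^n$, where $\boldsymbol{\mu}\in\mathbb{R}^n$ is a location parameter, $\boldsymbol{\Sigma}$ is a scale matrix (a positive-definite real $n\times n$ matrix), $|\boldsymbol{\Sigma}|$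 is its determinant, $g^{(n)}$ is the density generator and $k_n$ is a normalizing constant. The generator above is that of the multivariate Student-$t$ distribution with $\nu$ degrees of freedom. $\rho_{i,j}=\mathrm{Corr}(X_i,X_j)$ is the correlation of $X_i$ and $X_j$. Exchangeable means that $(X_1,\ldots,X_n)^\top$ has the same distribution as $(X_{i_1},\ldots,X_{i_n})^\top$ for every permutation $(i_1,\ldots,i_n)$ of $(1,\ldots,n)$. $\Gamma$ is the gamma function.
   Formalization: σ_1^2=Var(X_1) makes the formula false (or undefined for ν≤2); here σ_1=√Σ_{11} and ρ_{ij}=Σ_{ij}/√(Σ_{ii}Σ_{jj}). For ν>2 it is proved that Var(X_1)=ν/(ν−2)·σ_1^2 and ρ_{ij}=Corr(X_i,X_j). *)

(* Defs.v *)
From HB Require Import structures.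
From mathcomp Require Import all_boot all_order all_algebra perm.
From mathcomp Require Import all_classical all_reals all_analysis.

Set Implicit Arguments.
Unset Strict Implicit.
Unset Printing Implicit Defensive.

Import Order.TTheory GRing.Theory Num.Theory.
Import numFieldNormedType.Exports.

Local Open Scope classical_set_scope.
Local Open Scope ring_scope.

(* Lebesgue measure on R^n, with R^n represented by n.-tuple R and its product
   sigma-algebra: the unit point mass on R^0, and the image of the product of
   the one-dimensional measure with the measure on R^n under
   (x, t) |-> x :: t on R^(n+1). *)
Section lebesgue_cons.
Context (R : realType) (n : nat).
Variable m : {sigma_finite_measure set (n.-tuple R) -> \bar R}.

Definition cons_pair (p : measurableTypeR R * n.-tuple R) : n.+1.-tuple R :=
  [tuple of p.1 :: p.2].

Lemma measurable_cons_pair : measurable_fun setT cons_pair.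
Proof.
exact: (@measurable_cons _ _ _ R (fun p => p.1) n (fun p => p.2)
  measurable_fst measurable_snd).
Qed.

Definition lebesgue_cons : set (n.+1.-tuple R) -> \bar R :=
  pushforward (lebesgue_measure \x m)%E cons_pair.

Let prod : {measure set (measurableTypeR R * n.-tuple R)%type -> \bar R} :=
  (lebesgue_measure \x m)%E.

Let measurable_preimage A : measurable A -> measurable (cons_pair @^-1` A).
Proof. by move=> mA; rewrite -[X in measurable X]setTI; exact: measurable_cons_pair. Qed.

Let lebesgue_cons0 : lebesgue_cons set0 = 0%E.
Proof. by rewrite /lebesgue_cons /pushforward preimage_set0 (measure0 prod). Qed.

Let lebesgue_cons_ge0 A : (0 <= lebesgue_cons A)%E.
Proof. exact: (measure_ge0 prod). Qed.

Let lebesgue_cons_sigma_additive : semi_sigma_additive lebesgue_cons.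
Proof.
move=> F mF tF mUF; rewrite /lebesgue_cons /pushforward preimage_bigcup.
apply: (@measure_semi_sigma_additive _ _ _ prod).
- by move=> k; exact: measurable_preimage.
- apply/trivIsetP => /= i j _ _ ij; rewrite -preimage_setI.
  by move/trivIsetP : tF => /(_ _ _ _ _ ij) ->//; rewrite preimage_set0.
- by rewrite -preimage_bigcup; exact: measurable_preimage.
Qed.

HB.instance Definition _ := isMeasure.Build _ _ _ lebesgue_cons
  lebesgue_cons0 lebesgue_cons_ge0 lebesgue_cons_sigma_additive.

Let uncons (t : n.+1.-tuple R) : measurableTypeR R * n.-tuple R :=
  (tnth t ord0, [tuple of behead t]).

Let measurable_uncons : measurable_fun [set: n.+1.-tuple R] uncons.
Proof.
by apply/measurable_fun_pairP; split; [exact: measurable_tnth|exact: measurable_behead].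
Qed.

Let cons_pairK : cancel cons_pair uncons.
Proof.
by move=> [x t]; rewrite /uncons /=; congr pair; apply: val_inj.
Qed.

Lemma lebesgue_cons_sigma_finite : sigma_finite setT lebesgue_cons.
Proof.
have [F FT Foo] : sigma_finite setT (lebesgue_measure \x m)%E.
  have /sigma_finiteP[G [TG ndG Goo]] := sigma_finiteT (@lebesgue_measure R).
  have /sigma_finiteP[H [TH ndH Hoo]] := sigma_finiteT m.
  exists (fun k => G k `*` H k).
    rewrite -setXTT TG TH predeqE => -[x y]; split.
      move=> [/= [i _ Gix] [j _ Hjy]]; exists (maxn i j) => //; split.
      - by move: x Gix; exact/subsetPset/ndG/leq_maxl.
      - by move: y Hjy; exact/subsetPset/ndH/leq_maxr.
    by move=> [i _ []/= ? ?]; split; exists i.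
  move=> k; have [? ?] := Goo k; have [? ?] := Hoo k.
  split; first exact: measurableX.
  by rewrite product_measure1E// lte_mul_pinfty// ge0_fin_numE.
exists (fun k => uncons @^-1` F k).
  by rewrite -preimage_bigcup -FT preimage_setT.
move=> k; have [mF Fk] := Foo k; split.
  by rewrite -[X in measurable X]setTI; exact: measurable_uncons.
rewrite /lebesgue_cons /pushforward -comp_preimage.
by rewrite (_ : uncons \o cons_pair = id)//; apply/funext.
Qed.

HB.instance Definition _ := @Measure_isSigmaFinite.Build _ _ _
  lebesgue_cons lebesgue_cons_sigma_finite.

End lebesgue_cons.

Fixpoint lebesgue_tuple (R : realType) (n : nat) :
    {sigma_finite_measure set (n.-tuple R) -> \bar R} :=
  match n with
  | 0 => \d_([tuple] : 0.-tuple R)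
  | k.+1 => lebesgue_cons (lebesgue_tuple R k)
  end.

Definition vec_of (R : realType) (n : nat) (x : n.-tuple R) : 'cV[R]_n :=
  \col_i tnth x i.

Definition posdef (R : realType) (n : nat) (S : 'M[R]_n) : Prop :=
  S^T = S /\ forall v : 'cV[R]_n, v != 0 -> 0 < (v^T *m S *m v) 0 0.

Definition has_joint_density (R : realType) (d : measure_display)
    (T : measurableType d) (P : probability T R) (n : nat)
    (X : {RV P >-> n.-tuple R}) (f : n.-tuple R -> R) : Prop :=
  [/\ measurable_fun [set: n.-tuple R] f,
      forall x, 0 <= f x &
      forall A : set (n.-tuple R), measurable A ->
        distribution P X A = (\int[lebesgue_tuple R n]_(x in A) (f x)%:E)%E].

Definition elliptical_density (R : realType) (n : nat) (k : R)
    (mu : 'cV[R]_n) (Sigma : 'M[R]_n) (g : R -> R) (x : n.-tuple R) : R :=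
  k * (\det Sigma) `^ (- 2^-1) *
  g (((vec_of x - mu)^T *m invmx Sigma *m (vec_of x - mu)) 0 0).

(* EC_n(mu, Sigma, g). The normalizing constant k is not given by a formula:
   it is determined by the density having total mass 1. *)
Definition elliptical (R : realType) (d : measure_display)
    (T : measurableType d) (P : probability T R) (n : nat)
    (X : {RV P >-> n.-tuple R})
    (mu : 'cV[R]_n) (Sigma : 'M[R]_n) (g : R -> R) : Prop :=
  posdef Sigma /\
  exists k : R, has_joint_density X (elliptical_density k mu Sigma g).

Definition student_generator (R : realType) (nu : R) (n : nat) (x : R) : R :=
  (1 + x / nu) `^ (- ((nu + n%:R) / 2)).

Definition exchangeable (R : realType) (d : measure_display)
    (T : measurableType d) (P : probability T R) (n : nat)
    (X : {RV P >-> n.-tuple R}) : Prop :=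
  forall (s : 'S_n) (A : set (n.-tuple R)), measurable A ->
    P (X @^-1` A) = P ((fun w => [tuple tnth (X w) (s i) | i < n]) @^-1` A).

Definition component (R : realType) (T : Type) (n : nat) (X : T -> n.-tuple R)
    (i : 'I_n) : T -> R := fun w => tnth (X w) i.

(* Extended-real valued, so that an equation GMD P X = r%:E with r : R entails
   that all the expectations involved are finite. *)
Definition GMD (R : realType) (d : measure_display)
    (T : measurableType d) (P : probability T R) (n : nat)
    (X : T -> n.-tuple R) : \bar R :=
  ((('C(n, 2))%:R^-1 : R)%:E *
   \sum_(i < n) \sum_(j < n | (i < j)%N)
     'E_P[fun w => `|component X i w - component X j w|%R])%E.

Definition corr (R : realType) (d : measure_display)
    (T : measurableType d) (P : probability T R) (U V : T -> R) : R :=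
  fine (covariance P U V) /
  (Num.sqrt (fine 'V_P[U]) * Num.sqrt (fine 'V_P[V])).

(* The correlation coefficients read off the scale matrix. They agree with corr
   when second moments exist, and remain meaningful when they do not. *)
Definition scale_corr (R : realType) (n : nat) (Sigma : 'M[R]_n)
    (i j : 'I_n) : R :=
  Sigma i j / (Num.sqrt (Sigma i i) * Num.sqrt (Sigma j j)).

Definition Gamma (R : realType) (a : R) : R :=
  \int[lebesgue_measure]_(x in `]0, +oo[) (x `^ (a - 1) * expR (- x)).

(* Main.v *)
Require Import Defs.
From mathcomp Require Import all_boot all_order all_algebra.
From mathcomp Require Import all_classical all_reals all_analysis.
From mathcomp Require Import perm measurable_realfun ring lra.

(** The Gini mean difference, the mean, the variance and the correlations of X
    are all moments of linear forms a.(X - mu), and each such form is a Student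
    variable with scale parameter the square root of the value at a of the
    quadratic form of Sigma ([student_linform]).

    That statement is proved by slicing the space by the hyperplanes a.x = y.
    In the metric of the inverse of Sigma, Pythagoras' theorem
    ([quadform_pythagoras]) splits the squared norm of a point of the slice
    into y^2 / s2, where s2 is the value at a of the form of Sigma, and the
    squared norm of its displacement inside the slice, measured from the point
    nearest to the origin. With rho = 1 + y^2 / (nu s2), translating by that
    nearest point and dilating by the square root of rho makes all slices
    alike; the slices have dimension n - 1, so the integral of the Student
    kernel over the slice is a constant times rho raised to
    (n - 1) / 2 - (nu + n) / 2 = - (nu + 1) / 2 ([linform_integral]). This is
    the one-dimensional Student kernel. All constants, in particular the
    determinant of Sigma and the mass of a slice, are independent of the
    function being averaged and are recovered at the end from the total mass 1.

    It remains to integrate against w(u) = (1 + u^2)^(- (nu + 1) / 2). The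
    integral of |u| w(u) is 2 / (nu - 1), and (nu - 2) times the integral of
    u^2 w(u) is the integral of w(u), both by the fundamental theorem of
    calculus ([student_first_moment], [student_second_moment]). The integral of
    w is the square root of pi times Gamma (nu / 2) / Gamma ((nu + 1) / 2), by
    writing w as a mixture of Gaussian functions and exchanging the integrals
    ([gamma_student_mass]).

    Exchangeability makes all coordinates of mu equal, because they are the
    means, and all diagonal entries of Sigma equal, because they are determined
    by the mean absolute deviations. The difference of coordinates i and j is
    then a linear form of X - mu with s2 = 2 Sigma_11 (1 - rho_ij), which
    gives the formula term by term ([student_gini_term]). *)

Set Implicit Arguments.
Unset Strict Implicit.
Unset Printing Implicit Defensive.

Import Order.TTheory GRing.Theory Num.Theory.
Import numFieldNormedType.Exports.

Local Open Scope classical_set_scope.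
Local Open Scope ring_scope.

(** * Affine changes of variables on the line *)

Lemma measurable_affine (R : realType) (c r : R) :
  measurable_fun [set: measurableTypeR R]
    (fun x => c + r * x : measurableTypeR R).
Proof. by apply: measurable_funD => //; apply: measurable_funM. Qed.

(** Both sides are measures in A, so by uniqueness of Lebesgue measure only
    half-open intervals need checking. The right-hand side is the image by
    the affine map of a multiple of Lebesgue measure. *)
Lemma lebesgue_measure_affine (R : realType) (c r : R) (A : set R) :
  r != 0 -> measurable A ->
  lebesgue_measure A =
  (`|r|%:E * lebesgue_measure ((fun x => c + r * x)%R @^-1` A))%E.
Proof.
move=> r0 mA.
pose phi : measurableTypeR R -> measurableTypeR R := fun x => c + r * x.
have mphi : measurable_fun setT phi by exact: measurable_affine.
pose k : {nonneg R} := NngNum (normr_ge0 r).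
rewrite -[RHS]/(pushforward (mscale k lebesgue_measure) phi A).
apply: lebesgue_measure_unique => //= _ [[a b]] _ <-.
rewrite /pushforward/= /mscale/=.
have [r_lt0|r_gt0|/eqP] := ltgtP r 0; last by rewrite (negPf r0).
  rewrite (_ : _ @^-1` _ = `[(b - c) / r, (a - c) / r[%classic); last first.
    apply/seteqP; split => x /=; rewrite !in_itv/= /phi ler_ndivrMr// ltr_ndivlMr//;
    by move=> /andP[? ?]; apply/andP; split; lra.
  rewrite !lebesgue_measure_itv/= !lte_fin ltr_nM2r ?invr_lt0// ltrD2r.
  case: ifP => _; last by rewrite mule0.
  by rewrite -!EFinD -EFinM ltr0_norm//; congr EFin; field; apply: ltr0_neq0.
rewrite (_ : _ @^-1` _ = `](a - c) / r, (b - c) / r]%classic); last first.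
    apply/seteqP; split => x /=; rewrite !in_itv/= /phi ler_pdivlMr// ltr_pdivrMr//;
    by move=> /andP[? ?]; apply/andP; split; lra.
rewrite !lebesgue_measure_itv/= !lte_fin ltr_pM2r ?invr_gt0// ltrD2r.
case: ifP => _; last by rewrite mule0.
by rewrite -!EFinD -EFinM gtr0_norm//; congr EFin; field; apply: lt0r_neq0.
Qed.

Lemma ge0_integral_affine (R : realType) (c r : R) (f : R -> \bar R) :
  r != 0 -> measurable_fun setT f -> (forall x, 0 <= f x)%E ->
  (\int[lebesgue_measure]_x f (c + r * x)%R =
   `|r|^-1%:E * \int[lebesgue_measure]_x f x)%E.
Proof.
move=> r0 mf f0.
pose phi : measurableTypeR R -> measurableTypeR R := fun x => c + r * x.
have mphi : measurable_fun setT phi by exact: measurable_affine.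
pose k : {nonneg R} := NngNum (normr_ge0 r).
have -> : (\int[lebesgue_measure]_x f x =
    \int[pushforward (mscale k lebesgue_measure) phi]_x f x)%E.
  apply: eq_measure_integral => A mA _.
  exact: (lebesgue_measure_affine c r0 mA).
rewrite ge0_integral_pushforward// preimage_setT ge0_integral_mscale//=; last first.
  exact: measurableT_comp.
by rewrite muleA -EFinM mulVf ?normr_eq0// mul1e.
Qed.

(** The form of the change of variables in which the integral to be computed
    stands alone on the left. *)
Lemma ge0_integral_rescale (R : realType) (r : R) (f : R -> \bar R) :
  0 < r -> measurable_fun setT f -> (forall x, 0 <= f x)%E ->
  (\int[lebesgue_measure]_x f x =
   r%:E * \int[lebesgue_measure]_x f (r * x)%R)%E.
Proof.
move=> r0 mf f0; have := ge0_integral_affine 0 (lt0r_neq0 r0) mf f0.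
under eq_integral do rewrite add0r.
move=> ->; rewrite muleA -EFinM gtr0_norm// divff ?lt0r_neq0//.
by rewrite mul1e.
Qed.

(** * Iterated integrals and homotheties in dimension n *)

(** Tonelli's theorem, read through the construction of the measure as the
    image of a product measure. *)
Lemma lebesgue_tuple_cons (R : realType) (n : nat)
    (f : n.+1.-tuple R -> \bar R) :
  measurable_fun setT f -> (forall x, 0 <= f x)%E ->
  (\int[lebesgue_tuple R n.+1]_x f x =
   \int[lebesgue_measure]_x \int[lebesgue_tuple R n]_t f [tuple of x :: t])%E.
Proof.
move=> mf f0; rewrite /= /lebesgue_cons.
rewrite ge0_integral_pushforward//; last exact: measurable_cons_pair.
rewrite fubini_tonelli1//=.
by apply: measurableT_comp => //; exact: measurable_cons_pair.
Qed.

(** Coordinate p is set apart because the linear forms of interest, such as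
    the difference of two coordinates, need not involve the first one. *)
Definition insert_tuple (R : realType) (n : nat) (p : 'I_n.+1) (y : R)
    (t : n.-tuple R) : n.+1.-tuple R :=
  [tuple if unlift p i is Some j then tnth t j else y | i < n.+1].

Lemma measurable_insert_tuple (R : realType) (n : nat) (p : 'I_n.+1)
    d (T : measurableType d) (y : T -> measurableTypeR R)
    (t : T -> n.-tuple R) :
  measurable_fun setT y -> measurable_fun setT t ->
  measurable_fun setT (fun w => insert_tuple p (y w) (t w) : n.+1.-tuple R).
Proof.
move=> my mt; apply/measurable_fun_tnthP => i.
rewrite /comp; under eq_fun do rewrite tnth_mktuple.
case: (unlift p i) => [j|//].
by apply: (measurableT_comp (measurable_tnth j)).
Qed.

Lemma insert_tuple0 (R : realType) (n : nat) (y : R) (t : n.-tuple R) :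
  insert_tuple ord0 y t = [tuple of y :: t].
Proof.
apply: eq_from_tnth => i; rewrite tnth_mktuple.
by case: (unliftP ord0 i) => [j|] ->; rewrite ?tnthS// tnth0.
Qed.

Lemma insert_tuple_lift (R : realType) (n : nat) (q : 'I_n.+1) (x y : R)
    (t : n.-tuple R) :
  insert_tuple (lift ord0 q) y [tuple of x :: t] =
  [tuple of x :: insert_tuple q y t].
Proof.
apply: eq_from_tnth => i; rewrite tnth_mktuple.
case: (unliftP ord0 i) => [j|] ->.
  rewrite tnthS tnth_mktuple.
  case: (unliftP q j) => [k|] ->.
    have -> : lift ord0 (lift q k) = lift (lift ord0 q) (lift ord0 k).
      by apply: val_inj; rewrite /= /bump !leq0n !add1n addnS ltnS.
    by rewrite liftK tnthS.
  by rewrite unlift_none.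
have -> : ord0 = lift (lift ord0 q) ord0 by apply: val_inj; rewrite /= /bump.
by rewrite liftK !tnth0.
Qed.

(** Any coordinate can be integrated last: peel off the first coordinate,
    use the induction hypothesis for the other ones, and exchange the two
    one-dimensional integrals by Tonelli's theorem. *)
Lemma lebesgue_tuple_insert (R : realType) (n : nat) (p : 'I_n.+1)
    (f : n.+1.-tuple R -> \bar R) :
  measurable_fun setT f -> (forall x, 0 <= f x)%E ->
  (\int[lebesgue_tuple R n.+1]_x f x =
   \int[lebesgue_measure]_y \int[lebesgue_tuple R n]_t f (insert_tuple p y t))%E.
Proof.
elim: n p f => [|n IH] p f mf f0.
  rewrite (lebesgue_tuple_cons mf f0); apply: eq_integral => y _.
  by apply: eq_integral => t _; rewrite (ord1 p) insert_tuple0.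
(* p = 0 is the definition; otherwise p is the successor of q. *)
case: (unliftP ord0 p) => [q|] ->; last first.
  rewrite (lebesgue_tuple_cons mf f0); apply: eq_integral => y _.
  by apply: eq_integral => t _; rewrite insert_tuple0.
rewrite (lebesgue_tuple_cons mf f0).
have mfx x : measurable_fun setT (fun s : n.+1.-tuple R => f [tuple of x :: s]).
  apply: measurableT_comp => //.
  exact: (@measurable_cons _ _ _ _ (fun=> x)).
under eq_integral => x _ do rewrite (IH q)//.
pose F (z : (measurableTypeR R * measurableTypeR R) * n.-tuple R) :=
  f [tuple of z.1.1 :: insert_tuple q z.1.2 z.2].
have mF : measurable_fun setT F.
  apply: measurableT_comp => //.
  apply: (@measurable_cons _ _ _ _ (fun z : (measurableTypeR R * measurableTypeR R) * n.-tuple R => z.1.1)).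
    exact: measurableT_comp.
  by apply: measurable_insert_tuple => //; exact: measurableT_comp.
have mG := measurable_fun_fubini_tonelli_F F mF (fun z => f0 _)
  (m2 := lebesgue_tuple R n).
rewrite (fubini_tonelli (fubini_F (lebesgue_tuple R n) F))//; last first.
  by move=> z; rewrite /fubini_F; apply: integral_ge0 => t _; exact: f0.
apply: eq_integral => y _; rewrite lebesgue_tuple_cons; first last.
- by move=> s; exact: f0.
- by apply: measurableT_comp => //; exact: measurable_insert_tuple.
by apply: eq_integral => x _; apply: eq_integral => t _; rewrite insert_tuple_lift.
Qed.

Definition affine_tuple (R : realType) (n : nat) (c : n.-tuple R) (r : R)
    (t : n.-tuple R) : n.-tuple R :=
  [tuple tnth c i + r * tnth t i | i < n].

Lemma measurable_affine_tuple (R : realType) (n : nat) (c : n.-tuple R) (r : R) :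
  measurable_fun setT (affine_tuple c r : n.-tuple R -> n.-tuple R).
Proof.
apply/measurable_fun_tnthP => i.
rewrite /comp; under eq_fun do rewrite tnth_mktuple.
apply: measurable_funD => //; apply: measurable_funM => //.
exact: measurable_tnth.
Qed.

(** Induction on the dimension, each coordinate contributing one factor
    by the one-dimensional change of variables. *)
Lemma ge0_integral_affine_tuple (R : realType) (n : nat) (c : n.-tuple R)
    (r : R) (f : n.-tuple R -> \bar R) :
  r != 0 -> measurable_fun setT f -> (forall x, 0 <= f x)%E ->
  (\int[lebesgue_tuple R n]_x f (affine_tuple c r x) =
   (`|r| ^- n)%:E * \int[lebesgue_tuple R n]_x f x)%E.
Proof.
move=> r0; elim: n c f => [|n IH] c f mf f0.
  rewrite expr0 invr1 mul1e; apply: eq_integral => x _.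
  by congr f; rewrite [RHS]tuple0 [LHS]tuple0.
rewrite (lebesgue_tuple_cons mf f0) (@lebesgue_tuple_cons _ _ (f \o affine_tuple c r)); first last.
- by move=> s; exact: f0.
- by apply: measurableT_comp => //; exact: measurable_affine_tuple.
have mfx x : measurable_fun setT (fun s : n.-tuple R => f [tuple of x :: s]).
  apply: measurableT_comp => //.
  exact: (@measurable_cons _ _ _ _ (fun=> x)).
have mF : measurable_fun setT (fun x : measurableTypeR R =>
    \int[lebesgue_tuple R n]_t f [tuple of x :: t])%E.
  apply: (measurable_fun_fubini_tonelli_F (f \o @cons_pair R n)).
    by apply: measurableT_comp => //; exact: measurable_cons_pair.
  by move=> z; exact: f0.
have F0 x : (0 <= \int[lebesgue_tuple R n]_t f [tuple of x :: t])%E.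
  exact: integral_ge0.
rewrite exprSr invfM EFinM -muleA -(ge0_integral_affine (tnth c ord0) r0 mF F0).
rewrite -ge0_integralZl//; last first.
  by apply: (measurableT_comp mF); exact: measurable_affine.
apply: eq_integral => x _.
rewrite -(IH [tuple of behead c] _ (mfx _)) => [|t]; last exact: f0.
apply: eq_integral => t _.
congr f; apply: eq_from_tnth => i; rewrite tnth_mktuple.
case: (unliftP ord0 i) => [j|] ->; rewrite ?tnthS ?tnth_mktuple ?tnth0//.
by rewrite tnth_behead; congr (tnth c _ + _); apply: val_inj; rewrite /= inordK// ltnS.
Qed.

Lemma ge0_integral_rescale_tuple (R : realType) (n : nat) (c : n.-tuple R)
    (r : R) (f : n.-tuple R -> \bar R) :
  0 < r -> measurable_fun setT f -> (forall x, 0 <= f x)%E ->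
  (\int[lebesgue_tuple R n]_x f x =
   (r ^+ n)%:E * \int[lebesgue_tuple R n]_x f (affine_tuple c r x))%E.
Proof.
move=> r0 mf f0; rewrite (ge0_integral_affine_tuple c (lt0r_neq0 r0) mf f0).
move: (integral _ _ _) => I.
by rewrite muleA -EFinM gtr0_norm// divff ?expf_neq0 ?lt0r_neq0// mul1e.
Qed.

(** * Linear and quadratic forms, and coordinates on a hyperplane *)

Definition linform (R : realType) (n : nat) (a v : 'cV[R]_n) : R :=
  (a^T *m v) 0 0.

Definition quadform (R : realType) (n : nat) (A : 'M[R]_n) (v : 'cV[R]_n) : R :=
  (v^T *m A *m v) 0 0.

Section forms.
Context {R : realType} {n : nat}.
Implicit Types (a u v w : 'cV[R]_n) (A Sigma : 'M[R]_n).

Lemma linformE a v : linform a v = \sum_i a i 0 * v i 0.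
Proof. by rewrite /linform mxE; apply: eq_bigr => i _; rewrite mxE. Qed.

Lemma linformC a v : linform a v = linform v a.
Proof. by rewrite !linformE; apply: eq_bigr => i _; rewrite mulrC. Qed.

Lemma linformD a v w : linform a (v + w) = linform a v + linform a w.
Proof. by rewrite /linform mulmxDr mxE. Qed.

Lemma linformB a v w : linform a (v - w) = linform a v - linform a w.
Proof. by rewrite /linform mulmxBr !mxE. Qed.

Lemma linformZ a k v : linform a (k *: v) = k * linform a v.
Proof. by rewrite /linform -scalemxAr mxE. Qed.

Lemma quadformE A v : quadform A v = linform v (A *m v).
Proof. by rewrite /quadform /linform mulmxA. Qed.

Lemma quadformZ A k v : quadform A (k *: v) = k ^+ 2 * quadform A v.
Proof.
by rewrite !quadformE -scalemxAr linformZ linformC linformZ linformC mulrA expr2.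
Qed.

(** A vector killed by a positive definite matrix has zero quadratic form. *)
Lemma posdef_unitmx Sigma : posdef Sigma -> Sigma \in unitmx.
Proof.
move=> [_ pd]; rewrite unitmxE unitfE; apply/negP => /det0P[v v0 vS].
have := pd v^T; rewrite trmxK vS mul0mx mxE ltxx => vT0.
suff: v^T != 0 by move=> /vT0.
by apply: contraNneq v0 => /(congr1 trmx); rewrite trmxK trmx0 => ->.
Qed.

(** Substituting v = Sigma w turns the form of the inverse matrix at v into
    the form of Sigma at w. *)
Lemma invmx_quadform_ge0 Sigma v : posdef Sigma -> 0 <= quadform (invmx Sigma) v.
Proof.
move=> Spd; have [SS pd] := Spd; have Su := posdef_unitmx Spd.
pose w := invmx Sigma *m v.
have vE : v = Sigma *m w by rewrite /w mulKVmx.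
have -> : quadform (invmx Sigma) v = quadform Sigma w.
  by rewrite !quadformE -/w -vE linformC.
have [->|w0] := eqVneq w 0; last exact/ltW/pd.
by rewrite quadformE mulmx0 /linform mulmx0 mxE.
Qed.

(** Pythagoras' theorem for the scalar product of the inverse matrix: since
    the linear form a is the scalar product with Sigma a, the point of the
    hyperplane a.x = y nearest to the origin is a multiple of Sigma a, and its
    squared norm is the square of y divided by the value at a of the form of
    Sigma. *)
Lemma quadform_pythagoras Sigma a v : posdef Sigma -> a != 0 ->
  quadform (invmx Sigma) v =
  linform a v ^+ 2 / quadform Sigma a +
  quadform (invmx Sigma)
    (v - (linform a v / quadform Sigma a) *: (Sigma *m a)).
Proof.
move=> Spd a0; have [SS pd] := Spd; have Su := posdef_unitmx Spd.
have s0 : quadform Sigma a != 0 by exact/lt0r_neq0/pd.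
set c := _ / _; set z := Sigma *m a.
have Az : invmx Sigma *m z = a by rewrite mulKmx.
have zA w : linform z (invmx Sigma *m w) = linform a w.
  by rewrite /linform mulmxA trmx_mul SS mulmxK.
have az : linform a z = quadform Sigma a by rewrite quadformE.
rewrite !quadformE mulmxBr linformB -scalemxAr Az linformZ.
rewrite ![linform (v - _) _]linformC !linformB !linformZ az.
rewrite [linform (_ *m v) z]linformC zA ![linform (_ *m v) v]linformC.
by rewrite -quadformE /c; field.
Qed.

End forms.

Section symmetric_forms.
Context {R : realType} {n : nat} (Sigma : 'M[R]_n).
Hypothesis SS : Sigma^T = Sigma.
Implicit Types (a b v : 'cV[R]_n).

Lemma linform_sym a b : linform a (Sigma *m b) = linform b (Sigma *m a).
Proof. by rewrite [RHS]linformC /linform mulmxA trmx_mul SS. Qed.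

Lemma quadformD a b : quadform Sigma (a + b) =
  quadform Sigma a + 2 * linform a (Sigma *m b) + quadform Sigma b.
Proof.
rewrite !quadformE mulmxDr linformD ![linform (a + b) _]linformC !linformD.
rewrite ![linform (Sigma *m _) _]linformC (linform_sym b a).
by ring.
Qed.

Lemma linformNl a v : linform (- a) v = - linform a v.
Proof. by rewrite -scaleN1r linformC linformZ mulN1r linformC. Qed.

Lemma quadformN a : quadform Sigma (- a) = quadform Sigma a.
Proof. by rewrite -scaleN1r quadformZ sqrrN expr1n mul1r. Qed.

Lemma linform_delta i v : linform (delta_mx i 0) v = v i 0.
Proof.
rewrite linformE (bigD1 i)//= mxE !eqxx mul1r big1 ?addr0// => j ji.
by rewrite mxE (negbTE ji) mul0r.
Qed.

Lemma linform_mul_delta i j :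
  linform (delta_mx i 0) (Sigma *m delta_mx j 0) = Sigma i j.
Proof. by rewrite linform_delta -colE mxE. Qed.

Lemma quadform_delta i : quadform Sigma (delta_mx i 0) = Sigma i i.
Proof. by rewrite quadformE linform_mul_delta. Qed.

End symmetric_forms.

Lemma posdef_diag_gt0 (R : realType) (n : nat) (Sigma : 'M[R]_n) i :
  posdef Sigma -> 0 < Sigma i i.
Proof.
move=> Spd; rewrite -quadform_delta; apply: Spd.2.
apply/eqP => /matrixP/(_ i 0).
by rewrite !mxE !eqxx => /eqP; rewrite oner_eq0.
Qed.

Section hyperplane.
Context {R : realType} {n : nat} (a : 'cV[R]_n.+1) (p : 'I_n.+1).
Hypothesis ap : a p 0 != 0.

(** The hyperplane a.x = y is parametrised by its coordinates other than p,
    which is possible because the coefficient of a at p is nonzero. *)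
Definition hyper_tuple (y : R) (t : n.-tuple R) : n.+1.-tuple R :=
  insert_tuple p
    ((y - \sum_(j < n) a (lift p j) 0 * tnth t j) / a p 0) t.

Lemma linform_insert (x : R) (t : n.-tuple R) :
  linform a (vec_of (insert_tuple p x t)) =
  a p 0 * x + \sum_(j < n) a (lift p j) 0 * tnth t j.
Proof.
rewrite linformE (bigD1_ord p)//= mxE tnth_mktuple unlift_none; congr +%R.
by apply: eq_bigr => j _; rewrite mxE tnth_mktuple liftK.
Qed.

Lemma linform_hyper (y : R) (t : n.-tuple R) :
  linform a (vec_of (hyper_tuple y t)) = y.
Proof. by rewrite linform_insert mulrCA divff// mulr1 subrK. Qed.

Lemma hyper_off (y : R) (t : n.-tuple R) j :
  vec_of (hyper_tuple y t) (lift p j) 0 = tnth t j.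
Proof. by rewrite mxE tnth_mktuple liftK. Qed.

Lemma eq_hyper (v w : 'cV[R]_n.+1) : linform a v = linform a w ->
  (forall j, v (lift p j) 0 = w (lift p j) 0) -> v = w.
Proof.
rewrite !linformE !(bigD1_ord p)//= => + vw.
under eq_bigr do rewrite vw.
move=> /addIr /(mulfI ap) vwp.
apply/matrixP => i k; rewrite (ord1 k).
by case: (unliftP p i) => [j|] ->.
Qed.

(** The coordinates, in this parametrisation, of the point of the hyperplane
    nearest to the origin. *)
Definition hyper_center (Sigma : 'M[R]_n.+1) (y : R) : n.-tuple R :=
  [tuple y / quadform Sigma a * (Sigma *m a) (lift p j) 0 | j < n].

(** In coordinates centred at the nearest point, the form on the hyperplane
    at height y is a constant plus the form on the parallel hyperplane through
    the origin: the offset depends on y, the shape does not. *)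
Lemma quadform_hyper (Sigma : 'M[R]_n.+1) (y r : R) (u : n.-tuple R) :
  posdef Sigma ->
  quadform (invmx Sigma)
    (vec_of (hyper_tuple y (affine_tuple (hyper_center Sigma y) r u))) =
  y ^+ 2 / quadform Sigma a +
  r ^+ 2 * quadform (invmx Sigma) (vec_of (hyper_tuple 0 u)).
Proof.
move=> Spd; have a0 : a != 0 by apply: contraNneq ap => ->; rewrite mxE.
rewrite (quadform_pythagoras _ Spd a0) linform_hyper -quadformZ.
congr (_ + quadform _ _); apply: eq_hyper => [|j].
  rewrite linformB linform_hyper !linformZ linform_hyper mulr0 -quadformE.
  by rewrite divfK ?subrr//; exact/lt0r_neq0/Spd.2.
rewrite [RHS]mxE hyper_off [LHS]mxE hyper_off [X in _ + X]mxE [X in _ - X]mxE.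
by rewrite !tnth_mktuple addrC addKr.
Qed.

End hyperplane.

Section measurability.
Context {R : realType} {n : nat}.

Lemma measurable_vec_of (d : measure_display) (T : measurableType d)
    (x : T -> n.-tuple R) (m : nat) (M : 'M[R]_(m, n)) i :
  measurable_fun setT x ->
  measurable_fun setT (fun t => (M *m vec_of (x t)) i 0).
Proof.
move=> mx; under eq_fun do rewrite mxE; apply: measurable_sum => j.
apply: measurable_funM => //; under eq_fun do rewrite mxE.
exact: (measurableT_comp (measurable_tnth j)).
Qed.

Lemma measurable_linform (d : measure_display) (T : measurableType d)
    (x : T -> n.-tuple R) (a : 'cV[R]_n) :
  measurable_fun setT x ->
  measurable_fun setT (fun t => linform a (vec_of (x t))).
Proof. exact: measurable_vec_of. Qed.

Lemma measurable_quadform (d : measure_display) (T : measurableType d)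
    (x : T -> n.-tuple R) (A : 'M[R]_n) :
  measurable_fun setT x ->
  measurable_fun setT (fun t => quadform A (vec_of (x t))).
Proof.
move=> mx; under eq_fun do rewrite quadformE linformE.
apply: measurable_sum => j; apply: measurable_funM.
  by under eq_fun do rewrite mxE; exact: (measurableT_comp (measurable_tnth j)).
exact: measurable_vec_of.
Qed.

End measurability.

(** * Slicing the Student density by hyperplanes *)

Lemma measurable_fun_powR (R : realType) (d : measure_display)
    (T : measurableType d) (f : T -> R) (p : R) :
  measurable_fun setT f -> measurable_fun setT (fun x => f x `^ p).
Proof. exact: (measurableT_comp (measurable_powR p)). Qed.

Lemma measurable_hyper_tuple (R : realType) (n : nat) (a : 'cV[R]_n.+1)
    (p : 'I_n.+1) (d : measure_display) (T : measurableType d)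
    (y : T -> measurableTypeR R) (t : T -> n.-tuple R) :
  measurable_fun setT y -> measurable_fun setT t ->
  measurable_fun setT (fun w => hyper_tuple a p (y w) (t w) : n.+1.-tuple R).
Proof.
move=> my mt; apply: measurable_insert_tuple => //.
apply: measurable_funM => //; apply: measurable_funB => //.
apply: measurable_sum => j; apply: measurable_funM => //.
exact: (measurableT_comp (measurable_tnth j)).
Qed.

(** Integration over parallel hyperplanes: for fixed remaining coordinates,
    y = a.x is an affine function of coordinate p, of slope the coefficient of
    a at p; then the order of integration is exchanged. *)
Lemma ge0_integral_hyper (R : realType) (n : nat) (a : 'cV[R]_n.+1)
    (p : 'I_n.+1) (F : n.+1.-tuple R -> \bar R) :
  a p 0 != 0 -> measurable_fun setT F -> (forall x, 0 <= F x)%E ->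
  (\int[lebesgue_tuple R n.+1]_x F x =
   `|a p 0|^-1%:E * \int[lebesgue_measure]_y
     \int[lebesgue_tuple R n]_t F (hyper_tuple a p y t))%E.
Proof.
move=> ap mF F0; rewrite (lebesgue_tuple_insert p mF F0).
rewrite (fubini_tonelli (fun z : measurableTypeR R * n.-tuple R => F (insert_tuple p z.1 z.2))); first last.
- by move=> z; exact: F0.
- by apply: measurableT_comp => //; exact: measurable_insert_tuple.
pose H (z : measurableTypeR R * n.-tuple R) := F (hyper_tuple a p z.1 z.2).
have mH : measurable_fun setT H.
  by apply: measurableT_comp => //; exact: measurable_hyper_tuple.
have H0 z : (0 <= H z)%E by exact: F0.
transitivity (\int[lebesgue_tuple R n]_t
    (`|a p 0|^-1%:E * \int[lebesgue_measure]_y H (y, t)))%E.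
  apply: eq_integral => t _.
  have mHt : measurable_fun setT (fun y => H (y, t)).
    by apply: (measurableT_comp mH); exact: measurable_pair2.
  have <- := ge0_integral_affine (\sum_(j < n) a (lift p j) 0 * tnth t j) ap
    mHt (fun y => H0 (y, t)).
  apply: eq_integral => x _; congr F; congr (insert_tuple p _ t).
  by rewrite /= addrC addKr mulrC mulKf.
rewrite ge0_integralZl//; last 2 first.
- exact: (measurable_fun_fubini_tonelli_G H mH H0).
- by move=> t _; apply: integral_ge0.
by rewrite -(fubini_tonelli H).
Qed.

Section elliptical_section.
Context {R : realType} {n : nat} (Sigma : 'M[R]_n.+1) (a : 'cV[R]_n.+1).
Variables (p : 'I_n.+1) (nu b : R).
Hypotheses (Spd : posdef Sigma) (ap : a p 0 != 0) (nu0 : 0 < nu).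

Definition student_form (v : 'cV[R]_n.+1) : R :=
  (1 + quadform (invmx Sigma) v / nu) `^ (- b).

Lemma student_form_ge0 v : 0 <= student_form v. Proof. exact: powR_ge0. Qed.

Lemma measurable_student_form d (T : measurableType d) (x : T -> n.+1.-tuple R) :
  measurable_fun setT x ->
  measurable_fun setT (fun w => (student_form (vec_of (x w)))%:E).
Proof.
move=> mx; apply/measurable_EFinP; apply: measurable_fun_powR.
apply: measurable_funD => //; apply: measurable_funM => //.
exact: measurable_quadform.
Qed.

(** The integral of the kernel over the hyperplane through the origin. It is
    kept in the extended reals: its value is never computed, and it cancels in
    the normalisation of the density. *)
Definition section_mass : \bar R :=
  (\int[lebesgue_tuple R n]_u (student_form (vec_of (hyper_tuple a p 0 u)))%:E)%E.

Let s2 := quadform Sigma a.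

Let s2_gt0 : 0 < s2.
Proof. by apply: Spd.2; apply: contraNneq ap => ->; rewrite mxE. Qed.

Let rho (y : R) : R := 1 + y ^+ 2 / s2 / nu.

Let rho_gt0 y : 0 < rho y.
Proof. by rewrite ltr_pwDl// !divr_ge0// ?sqr_ge0// ltW. Qed.

Let student_form_hyper y (u : n.-tuple R) :
  student_form (vec_of (hyper_tuple a p y
    (affine_tuple (hyper_center a p Sigma y) (Num.sqrt (rho y)) u))) =
  rho y `^ (- b) * student_form (vec_of (hyper_tuple a p 0 u)).
Proof.
rewrite /student_form quadform_hyper// sqr_sqrtr; last exact: ltW.
have q0 := invmx_quadform_ge0 (vec_of (hyper_tuple a p 0 u)) Spd.
rewrite -powRM; last 2 first.
- exact: ltW.
- by rewrite addr_ge0// divr_ge0// ltW.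
congr (_ `^ _); rewrite /rho -/s2; field.
by rewrite !lt0r_neq0.
Qed.

(** On the hyperplane at height y the kernel is that of the hyperplane through
    the origin, translated and dilated by the square root of
    rho = 1 + y^2 / (s2 nu), and multiplied by the power - b of rho. The
    dilation contributes the power n / 2 of rho. *)
Lemma integral_student_form_hyper y :
  (\int[lebesgue_tuple R n]_t (student_form (vec_of (hyper_tuple a p y t)))%:E =
   ((1 + y ^+ 2 / s2 / nu) `^ (n%:R / 2 - b))%:E * section_mass)%E.
Proof.
pose r := Num.sqrt (rho y); pose c := hyper_center a p Sigma y.
have r_gt0 : 0 < r by rewrite sqrtr_gt0.
have mf z : measurable_fun setT
    (fun t : n.-tuple R => (student_form (vec_of (hyper_tuple a p z t)))%:E).
  by apply: measurable_student_form; exact: measurable_hyper_tuple.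
have f0 z t : (0 <= (student_form (vec_of (hyper_tuple a p z t)))%:E)%E.
  by rewrite lee_fin student_form_ge0.
have rE : (1 + y ^+ 2 / s2 / nu) `^ (n%:R / 2 - b) = r ^+ n * rho y `^ (- b).
  rewrite powRD; last by rewrite lt0r_neq0 ?implybT//; exact: rho_gt0.
  rewrite mulrC (mulrC n%:R) powRrM powR12_sqrt; last exact: ltW (rho_gt0 y).
  by rewrite powR_mulrn ?sqrtr_ge0// mulrC.
have E : (\int[lebesgue_tuple R n]_t (student_form (vec_of
    (hyper_tuple a p y (affine_tuple c r t))))%:E =
    (rho y `^ (- b))%:E * section_mass)%E.
  rewrite /section_mass -(ge0_integralZl_EFin (lebesgue_tuple R n) measurableT
    (fun u _ => f0 0 u) (mf 0) (powR_ge0 _ _)).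
  by apply: eq_integral => u _; rewrite -EFinM -student_form_hyper.
rewrite (ge0_integral_rescale_tuple c r_gt0 (mf y) (f0 y)).
by rewrite [X in (_ * X)%E]E rE EFinM; exact: muleA.
Qed.

(** Up to a constant factor, the linear form a pushes the elliptical kernel
    with exponent - b in dimension n + 1 to the one-dimensional kernel with
    exponent n / 2 - b. *)
Lemma linform_integral (h : R -> \bar R) :
  measurable_fun setT h -> (forall y, 0 <= h y)%E ->
  (\int[lebesgue_tuple R n.+1]_x
     (h (linform a (vec_of x)) * (student_form (vec_of x))%:E) =
   `|a p 0|^-1%:E * section_mass * \int[lebesgue_measure]_y
     (h y * ((1 + y ^+ 2 / s2 / nu) `^ (n%:R / 2 - b))%:E))%E.
Proof.
move=> mh h0; rewrite (ge0_integral_hyper ap); first last.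
- by move=> x; rewrite mule_ge0// lee_fin student_form_ge0.
- apply: emeasurable_funM; last exact: measurable_student_form.
  by apply: measurableT_comp => //; exact: measurable_linform.
rewrite -muleA; congr mule; rewrite -ge0_integralZl//; last 3 first.
- apply: emeasurable_funM => //; apply/measurable_EFinP.
  apply: measurable_fun_powR.
  apply: measurable_funD => //; do 2 apply: measurable_funM => //.
- by move=> y _; rewrite mule_ge0// lee_fin powR_ge0.
- by apply: integral_ge0 => u _; rewrite lee_fin student_form_ge0.
apply: eq_integral => y _.
rewrite (eq_integral (fun t : n.-tuple R =>
    h y * (student_form (vec_of (hyper_tuple a p y t)))%:E)%E); last first.
  by move=> t _; rewrite linform_hyper.
rewrite ge0_integralZl//; last 2 first.
- by apply: measurable_student_form; exact: measurable_hyper_tuple.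
- by move=> t _; rewrite lee_fin student_form_ge0.
by rewrite integral_student_form_hyper muleA muleC.
Qed.

End elliptical_section.

(** * The law of a linear form *)

(** The density agrees almost everywhere with the Radon-Nikodym derivative,
    for which the change of measure is known. *)
Lemma ge0_integral_density (R : realType) (d : measure_display)
    (T : measurableType d) (nu : {finite_measure set T -> \bar R})
    (m : {sigma_finite_measure set T -> \bar R}) (f : T -> R)
    (h : T -> \bar R) :
  measurable_fun setT f ->
  (forall A, measurable A -> nu A = \int[m]_(x in A) (f x)%:E)%E ->
  measurable_fun setT h -> (forall x, 0 <= h x)%E ->
  (\int[nu]_x h x = \int[m]_x (h x * (f x)%:E))%E.
Proof.
move=> mf nuf mh h0.
have mfE : measurable_fun setT (EFin \o f) by exact/measurable_EFinP.
have num : nu `<< m.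
  apply/null_content_dominatesP => A mA A0; rewrite nuf//.
  by apply: null_set_integral => //; exact: measurable_funTS.
rewrite -(Radon_Nikodym_SigmaFinite.change_of_variables num)//.
have mg : measurable_fun setT (Radon_Nikodym_SigmaFinite.f nu m).
  exact: measurable_int (Radon_Nikodym_SigmaFinite.f_integrable num).
apply: ae_eq_integral => //; [exact: emeasurable_funM..|].
apply: ae_eqe_mul2l; apply: integral_ae_eq => //.
  exact: Radon_Nikodym_SigmaFinite.f_integrable num.
by move=> E _ mE; rewrite -nuf// -Radon_Nikodym_SigmaFinite.f_integral.
Qed.

(** The unnormalised density of a Student variable with nu degrees of freedom
    divided by the square root of nu. *)
Definition student_kernel (R : realType) (nu u : R) : R :=
  (1 + u ^+ 2) `^ (- ((nu + 1) / 2)).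

Lemma student_kernel_gt0 (R : realType) (nu u : R) : 0 < student_kernel nu u.
Proof. by rewrite powR_gt0// ltr_pwDl// sqr_ge0. Qed.

Lemma measurable_student_kernel (R : realType) (nu : R) :
  measurable_fun setT (student_kernel nu).
Proof. by apply: measurable_fun_powR; apply: measurable_funD. Qed.

Section student_linform.
Context {R : realType} {d : measure_display} {T : measurableType d}.
Context (P : probability T R) {n : nat} (mu : 'cV[R]_n.+1).
Context (Sigma : 'M[R]_n.+1) (nu : R) (nu0 : 0 < nu).
Context (X : {RV P >-> n.+1.-tuple R}).
Hypothesis ecX : elliptical X mu Sigma (student_generator nu n.+1).

Local Notation w := (student_kernel nu).

(** The constant D gathers the normalising constant of the density, the mass
    of a hyperplane section and the dilation factor. It depends on a but not on
    h, which is what allows its determination by the choice h = 1. *)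
Let student_linform_mass (a : 'cV[R]_n.+1) : a != 0 ->
  exists2 D : \bar R, (0 <= D)%E & forall h : R -> \bar R,
    measurable_fun setT h -> (forall y, 0 <= h y)%E ->
    (\int[P]_t h (linform a (vec_of (X t) - mu)) =
     D * \int[lebesgue_measure]_u
       (h (Num.sqrt (nu * quadform Sigma a) * u)%R * (w u)%:E))%E.
Proof.
move=> a0; have [Spd [k [mf f0 fX]]] := ecX.
have [p ap] : exists p, a p 0 != 0.
  apply/existsP; apply: contraNT a0; rewrite negb_exists => /forallP a0.
  apply/eqP/matrixP => i j; rewrite (ord1 j) mxE.
  by move: (a0 i); rewrite negbK => /eqP.
have s2_gt0 : 0 < quadform Sigma a by exact: Spd.2.
pose r := Num.sqrt (nu * quadform Sigma a).
have r_gt0 : 0 < r by rewrite sqrtr_gt0 mulr_gt0.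
pose K := k * (\det Sigma) `^ (- 2^-1).
pose b := (nu + n.+1%:R) / 2.
pose kern := student_form Sigma nu b.
have fE x : elliptical_density k mu Sigma (student_generator nu n.+1) x =
    K * kern (vec_of x - mu) by [].
have kern_gt0 v : 0 < kern v.
  by rewrite powR_gt0// ltr_pwDl// divr_ge0 ?invmx_quadform_ge0 ?(ltW nu0).
(* The density is nonnegative at one point and the kernel is positive. *)
have K0 : 0 <= K.
  by have := f0 [tuple 0 | i < n.+1]; rewrite fE pmulr_lge0.
exists (K%:E * (`|a p 0|^-1%:E * section_mass Sigma a p nu b) * r%:E)%E.
  rewrite !mule_ge0 ?lee_fin ?sqrtr_ge0 ?invr_ge0//.
  by apply: integral_ge0 => u _; rewrite lee_fin powR_ge0.
move=> h mh h0.
pose c : n.+1.-tuple R := [tuple - mu i 0 | i < n.+1].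
have vecB x : vec_of x - mu = vec_of (affine_tuple c 1 x).
  apply/matrixP => i j; rewrite (ord1 j) !mxE !tnth_mktuple.
  by rewrite mul1r addrC.
pose F (x : n.+1.-tuple R) := (h (linform a (vec_of x)) * (kern (vec_of x))%:E)%E.
have F0 x : (0 <= F x)%E by rewrite mule_ge0// lee_fin ltW.
have mF : measurable_fun setT F.
  apply: emeasurable_funM.
    by apply: measurableT_comp => //; exact: measurable_linform.
  exact: measurable_student_form.
pose h1 (x : n.+1.-tuple R) := h (linform a (vec_of (affine_tuple c 1 x))).
have mh1 : measurable_fun setT h1.
  apply: measurableT_comp => //; apply: measurable_linform.
  exact: measurable_affine_tuple.
transitivity (\int[distribution P X]_x h1 x)%E.
  rewrite ge0_integral_distribution//; last by move=> x; exact: h0.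
  by apply: eq_integral => t _; rewrite /h1 /= -vecB.
rewrite (ge0_integral_density mf fX mh1); last by move=> x; exact: h0.
have mFc : measurable_fun setT (F \o affine_tuple c 1).
  by apply: measurableT_comp => //; exact: measurable_affine_tuple.
transitivity (\int[lebesgue_tuple R n.+1]_x (K%:E * (F \o affine_tuple c 1) x))%E.
  by apply: eq_integral => x _; rewrite fE vecB /F EFinM muleCA.
have -> := ge0_integralZl_EFin (lebesgue_tuple R n.+1) measurableT
  (fun x _ => F0 (affine_tuple c 1 x)) mFc K0.
rewrite (ge0_integral_affine_tuple c (oner_neq0 R) mF F0).
rewrite normr1 expr1n invr1 mul1e /F (linform_integral b Spd ap nu0 mh h0).
rewrite -!muleA; congr (_ * (_ * (_ * _)))%E.
have mG : measurable_fun setT (fun y => h y *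
    ((1 + y ^+ 2 / quadform Sigma a / nu) `^ (n%:R / 2 - b))%:E)%E.
  apply: emeasurable_funM => //; apply/measurable_EFinP.
  apply: measurable_fun_powR.
  by apply: measurable_funD => //; do 2 apply: measurable_funM => //.
have G0 y : (0 <= h y *
    ((1 + y ^+ 2 / quadform Sigma a / nu) `^ (n%:R / 2 - b))%:E)%E.
  by rewrite mule_ge0// lee_fin powR_ge0.
rewrite (ge0_integral_rescale r_gt0 mG G0).
suff wE u : (1 + (r * u) ^+ 2 / quadform Sigma a / nu) `^ (n%:R / 2 - b) = w u.
  apply: (congr1 (mule r%:E)); apply: eq_integral => u _.
  by rewrite wE.
congr (_ `^ _).
  rewrite exprMn sqr_sqrtr ?mulr_ge0 ?ltW//; congr +%R; field.
  by rewrite !lt0r_neq0.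
by rewrite /b -(natr1 n); field.
Qed.

Let student_linform_total (a : 'cV[R]_n.+1) (D : \bar R) :
  (forall h : R -> \bar R, measurable_fun setT h -> (forall y, 0 <= h y)%E ->
    (\int[P]_t h (linform a (vec_of (X t) - mu)) =
     D * \int[lebesgue_measure]_u
       (h (Num.sqrt (nu * quadform Sigma a) * u)%R * (w u)%:E)))%E ->
  (D * \int[lebesgue_measure]_u (w u)%:E = 1)%E.
Proof.
move=> /(_ (cst 1%E) (measurable_cst _) (fun=> lee01)).
have -> : (\int[P]_t cst 1 (linform a (vec_of (X t) - mu)) = 1)%E.
  by rewrite (integral_cst P measurableT 1%E) mul1e; exact: probability_setT.
move=> ->.
by congr (_ * _)%E; apply: eq_integral => u _; rewrite mul1e.
Qed.

(** The mass W satisfies D W = 1 for some D, because the law of X has total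
    mass 1; hence it is neither zero nor infinite. *)
Lemma student_kernel_mass :
  exists2 W : R, 0 < W & (\int[lebesgue_measure]_u (w u)%:E = W%:E)%E.
Proof.
(* Any nonzero linear form will do. *)
have a0 : const_mx 1 != 0 :> 'cV[R]_n.+1.
  by apply/eqP => /matrixP/(_ 0 0); rewrite !mxE => /eqP; rewrite oner_eq0.
have [D D0 Dh] := student_linform_mass a0.
have := student_linform_total Dh.
have : (0 <= \int[lebesgue_measure]_u (w u)%:E)%E.
  by apply: integral_ge0 => u _; rewrite lee_fin ltW// student_kernel_gt0.
case: (\int[lebesgue_measure]_u (w u)%:E)%E => [W| |//].
  rewrite lee_fin le_eqVlt => /predU1P[<-|W0 _]; last by exists W.
  by rewrite mule0 => /eqP; rewrite eqe eq_sym oner_eq0.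
move: D0; rewrite le_eqVlt => /predU1P[<-|Dgt0] _.
  by rewrite mul0e => /eqP; rewrite eqe eq_sym oner_eq0.
by rewrite gt0_muley.
Qed.

(** Every linear form of the centred vector is distributed as a standard
    Student variable multiplied by a factor; for a = 0 that factor is zero and
    both sides reduce to h 0. *)
Lemma student_linform (a : 'cV[R]_n.+1) (h : R -> \bar R) :
  measurable_fun setT h -> (forall y, 0 <= h y)%E ->
  (\int[P]_t h (linform a (vec_of (X t) - mu)) =
   (\int[lebesgue_measure]_u w u)^-1%:E * \int[lebesgue_measure]_u
     (h (Num.sqrt (nu * quadform Sigma a) * u)%R * (w u)%:E))%E.
Proof.
move=> mh h0; have [W W0 WE] := student_kernel_mass.
rewrite /Rintegral WE /=.
have mw : measurable_fun setT (EFin \o w).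
  by apply/measurable_EFinP; exact: measurable_student_kernel.
have w0 u : (0 <= (w u)%:E)%E by rewrite lee_fin ltW// student_kernel_gt0.
have [->|a0] := eqVneq a 0.
  have -> : (\int[P]_t h (linform 0 (vec_of (X t) - mu)) = h 0%R)%E.
    rewrite (eq_integral (cst (h 0%R))) => [|t _].
      rewrite (integral_cst P measurableT (h 0%R)).
      rewrite -[RHS]mule1; congr (_ * _)%E; exact: probability_setT.
    by rewrite /linform trmx0 mul0mx mxE.
  have -> : (\int[lebesgue_measure]_u
      (h (Num.sqrt (nu * quadform Sigma 0) * u)%R * (w u)%:E) = h 0%R * W%:E)%E.
    rewrite -WE -(ge0_integralZl lebesgue_measure measurableT mw (fun u _ => w0 u) (h0 0)).
    apply: eq_integral => u _.
    by rewrite quadformE mulmx0 /linform mulmx0 mxE mulr0 sqrtr0 mul0r.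
  by rewrite muleCA -EFinM mulVf ?lt0r_neq0// mule1.
have [D D0 Dh] := student_linform_mass a0; rewrite Dh//; congr (_ * _)%E.
have := student_linform_total Dh; rewrite WE => /(congr1 (fun z => z * W^-1%:E)%E).
by rewrite mul1e -muleA -EFinM divff ?lt0r_neq0// mule1.
Qed.

End student_linform.

(** * Moments of the one-dimensional Student law *)

Lemma is_derive_powR1Dsqr (R : realType) (c u : R) :
  is_derive u 1 (fun x : R => (1 + x ^+ 2) `^ c)
    (c * (1 + u ^+ 2) `^ (c - 1) * (2 * u)).
Proof.
have B : is_derive u 1 (fun x : R => 1 + x ^+ 2) (2 * u).
  apply: is_derive_eq; rewrite add0r /GRing.scale/= mulr1.
  by rewrite mul1r mulr_natl.
have u0 : 0 < 1 + u ^+ 2 by rewrite ltr_pwDl// sqr_ge0.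
have D := is_derive1_powR c u0.
exact: (@is_derive1_comp R (@powR R ^~ c) (fun x : R => 1 + x ^+ 2) u _ _ D B).
Qed.

Lemma continuous_powR1Dsqr (R : realType) (c : R) :
  continuous (fun x : R => (1 + x ^+ 2) `^ c).
Proof.
move=> x; apply/differentiable_continuous/derivable1_diffP.
by have [] := is_derive_powR1Dsqr c x.
Qed.

Lemma powR1Dsqr_cvgy (R : realType) (c : R) : c < 0 ->
  (1 + x ^+ 2 : R) `^ c @[x --> +oo%R] --> (0 : R).
Proof.
move=> c0; apply/cvgrPdist_lt => e e0.
near=> x.
have x1 : 1 <= x by near: x; exact: nbhs_pinfty_ge.
have xe : e `^ c^-1 <= x by near: x; exact: nbhs_pinfty_ge.
have B0 : 0 < 1 + x ^+ 2 by rewrite ltr_pwDl// sqr_ge0.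
rewrite sub0r normrN ger0_norm ?powR_ge0// -[c]opprK powRN.
rewrite invf_plt ?posrE ?powR_gt0//.
have -> : e^-1 = (e `^ c^-1) `^ (- c).
  by rewrite -powRrM mulrN mulVf ?lt_eqF// powRN powRr1// ltW.
apply: gt0_ltr_powR; rewrite ?nnegrE ?powR_ge0 ?oppr_gt0 ?(ltW B0)//.
apply: (le_lt_trans xe); apply: (@le_lt_trans _ _ (x ^+ 2)).
  exact: ler_eXnr.
by rewrite ltrDr.
Unshelve. all: by end_near. Qed.

Lemma student_kernelE (R : realType) (nu u : R) :
  student_kernel nu u = (1 + u ^+ 2) `^ (- ((nu - 1) / 2) - 1).
Proof. by congr (_ `^ _); field. Qed.

Lemma student_kernel_ge0 (R : realType) (nu u : R) : 0 <= student_kernel nu u.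
Proof. exact/ltW/student_kernel_gt0. Qed.

Lemma continuous_student_kernel (R : realType) (nu : R) :
  continuous (student_kernel nu).
Proof. exact: continuous_powR1Dsqr. Qed.

Lemma student_kernelN (R : realType) (nu u : R) :
  student_kernel nu (- u) = student_kernel nu u.
Proof. by rewrite /student_kernel sqrrN. Qed.

Lemma ge0_even_integral (R : realType) (f : R -> R) :
  (forall x, 0 <= f x) -> continuous f -> (forall x, f (- x) = f x) ->
  (\int[lebesgue_measure]_x (f x)%:E =
   2%:E * \int[lebesgue_measure]_(x in `[0%R, +oo[) (f x)%:E)%E.
Proof.
move=> f0 cf fN; rewrite ge0_symfun_integralT//; last by move=> x; rewrite /= fN.
by rewrite -set_itvcy.
Qed.

(** The integrand on the half-line is the derivative of
    - (1 + u^2)^(- (nu - 1) / 2) / (nu - 1). *)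
Lemma student_first_moment (R : realType) (nu : R) : 1 < nu ->
  (\int[lebesgue_measure]_u (`|u| * student_kernel nu u)%:E = (2 / (nu - 1))%:E)%E.
Proof.
move=> nu1.
have cf : continuous (fun u : R => `|u| * student_kernel nu u).
  move=> x; apply: cvgM; first exact: norm_continuous.
  exact: continuous_student_kernel.
rewrite ge0_even_integral//; last 2 first.
- by move=> x; rewrite mulr_ge0// student_kernel_ge0.
- by move=> x; rewrite normrN student_kernelN.
pose c := - ((nu - 1) / 2).
pose F (u : R) := - (nu - 1)^-1 * (1 + u ^+ 2) `^ c.
have dF (u : R) : is_derive u (1 : R) F (u * student_kernel nu u).
  have := is_derive_powR1Dsqr c u => dG.
  have := is_deriveZ (- (nu - 1)^-1) dG.
  rewrite student_kernelE -/c (_ : _ *: _ = u * (1 + u ^+ 2) `^ (c - 1))//.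
  rewrite /GRing.scale/= /c; field.
  by rewrite subr_eq0 gt_eqF.
rewrite (@ge0_continuous_FTC2y _ _ F 0 0).
- by rewrite -EFinD -EFinM /F expr0n/= addr0 powR1 mulr1 opprK add0r.
- by move=> x x0; rewrite mulr_ge0// student_kernel_ge0.
- exact: continuous_subspaceT.
- rewrite -[X in _ --> X](mulr0 (- (nu - 1)^-1)).
  apply: cvgM; first exact: cvg_cst.
  by apply: powR1Dsqr_cvgy; rewrite oppr_lt0 divr_gt0// subr_gt0.
- by move=> x _; have [] := dF x.
- apply: cvg_at_right_filter.
  by apply/differentiable_continuous/derivable1_diffP; have [] := dF 0.
- move=> x; rewrite in_itv/= andbT => x0; rewrite derive1E gtr0_norm//.
  by have [_ ->] := dF x.
Qed.

(** The derivative of u (1 + u^2)^(- (nu - 1) / 2) is the kernel times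
    1 - (nu - 2) u^2. That primitive vanishes at 0 and, because nu > 2, at
    infinity. The identity is taken to the limit from the intervals [0, n] in
    the extended reals, so that finiteness of the second moment follows from
    that of the mass. *)
Lemma student_second_moment (R : realType) (nu : R) : 2 < nu ->
  ((nu - 2)%:E * \int[lebesgue_measure]_u (u ^+ 2 * student_kernel nu u)%:E =
   \int[lebesgue_measure]_u (student_kernel nu u)%:E)%E.
Proof.
move=> nu2; pose w : R -> R := student_kernel nu.
have cw : continuous w by exact: continuous_student_kernel.
have cq : continuous (fun u : R => u ^+ 2 * w u).
  by move=> x; apply: cvgM; [exact: exprn_continuous|exact: cw].
rewrite (@ge0_even_integral _ (fun u => u ^+ 2 * w u))//; last 2 first.
- by move=> x; rewrite mulr_ge0 ?sqr_ge0 ?student_kernel_ge0.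
- by move=> x; rewrite sqrrN /w student_kernelN.
rewrite (@ge0_even_integral _ w)//; last 2 first.
- by move=> x; rewrite student_kernel_ge0.
- exact: student_kernelN.
rewrite muleCA; congr (_ * _)%E.
pose c := - ((nu - 1) / 2).
pose F (u : R) := u * (1 + u ^+ 2) `^ c.
pose f (u : R) := w u - (nu - 2) * (u ^+ 2 * w u).
have cf : continuous f.
  move=> x; apply: cvgB; first exact: cw.
  by apply: cvgM; [exact: cvg_cst|exact: cq].
have dF (u : R) : is_derive u (1 : R) F (f u).
  have dG := is_derive_powR1Dsqr c u.
  have B0 : 0 < 1 + u ^+ 2 by rewrite ltr_pwDl// sqr_ge0.
  have E : (1 + u ^+ 2) `^ c = (1 + u ^+ 2) `^ (c - 1) * (1 + u ^+ 2).
    rewrite -[in LHS](subrK 1 c) powRD; last by apply/implyP => _; rewrite (gt_eqF B0).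
    by rewrite powRr1 ?ltW.
  apply: (is_derive_eq (is_deriveM (is_derive_id u (1 : R)) dG)).
  rewrite /f /w student_kernelE -/c E /GRing.scale/= /c.
  by field.
have Fn (n : nat) : (\int[lebesgue_measure]_(u in `[0%R, n.+1%:R]) (w u)%:E =
    (F n.+1%:R)%:E + (nu - 2)%:E *
      \int[lebesgue_measure]_(u in `[0%R, n.+1%:R]) (u ^+ 2 * w u)%:E)%E.
  have cI (g : R -> R) : continuous g ->
      lebesgue_measure.-integrable `[0%R, n.+1%:R] (EFin \o g).
    move=> cg; apply: continuous_compact_integrable; first exact: segment_compact.
    exact: continuous_subspaceT.
  have <- : (\int[lebesgue_measure]_(u in `[0%R, n.+1%:R]) (f u)%:E =
      (F n.+1%:R)%:E)%E.
    rewrite (@continuous_FTC2 _ f F)//.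
    - by rewrite /F mul0r sube0.
    - exact: continuous_subspaceT.
    - have cF x : {for x, continuous F}.
        by apply/differentiable_continuous/derivable1_diffP; have [] := dF x.
      split; first by move=> x _; have [] := dF x.
      - exact/cvg_at_right_filter/cF.
      - exact/cvg_at_left_filter/cF.
    - by move=> x _; rewrite derive1E; have [_ ->] := dF x.
  rewrite -integralZl//; last exact: cI.
  rewrite -integralD//; first last.
  - by apply: (cI (fun u => (nu - 2) * (u ^+ 2 * w u))) => x; apply: cvgM; [exact: cvg_cst|exact: cq].
  - exact: cI.
  by apply: eq_integral => u _; rewrite -EFinM -EFinD /f subrK.
have F0 : F n.+1%:R @[n --> \oo] --> (0 : R).
  (* x is at most the square root of 1 + x^2, so F is at most the power
     1/2 + c of 1 + x^2. *)
  pose c2 := - ((nu - 2) / 2).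
  apply: (@squeeze_cvgr _ _ _ _ (cst 0) (fun n => (1 + n.+1%:R ^+ 2) `^ c2)).
  - apply: nearW => n; rewrite mulr_ge0 ?powR_ge0//=.
    have B0 : 0 < 1 + (n.+1%:R : R) ^+ 2 by rewrite ltr_pwDl// sqr_ge0.
    have -> : c2 = 2^-1 + c by rewrite /c2 /c; field.
    rewrite powRD; last by apply/implyP => _; rewrite gt_eqF.
    rewrite ler_wpM2r ?powR_ge0// powR12_sqrt ?(ltW B0)//.
    by rewrite -[leLHS]ger0_norm// -sqrtr_sqr ler_wsqrtr// lerDr.
  - exact: cvg_cst.
  - rewrite (@cvg_shiftS _ (fun n => (1 + n%:R ^+ 2) `^ c2)).
    have c20 : c2 < 0 by rewrite oppr_lt0 divr_gt0// subr_gt0.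
    by have /cvg_pinftyP/(_ _ cvgr_idn) := powR1Dsqr_cvgy c20.
have lim1 : (\int[lebesgue_measure]_(u in `[0%R, n.+1%:R]) (w u)%:E)%E @[n --> \oo]
    --> (\int[lebesgue_measure]_(u in `[0%R, +oo[) (w u)%:E)%E.
  rewrite (@cvg_shiftS _ (fun n => \int[lebesgue_measure]_(u in `[0%R, n%:R]) (w u)%:E)%E).
  apply: ge0_cvgn_integral; first by move=> x; exact: student_kernel_ge0.
  exact: measurable_student_kernel.
have lim2 : (\int[lebesgue_measure]_(u in `[0%R, n.+1%:R]) (u ^+ 2 * w u)%:E)%E @[n --> \oo]
    --> (\int[lebesgue_measure]_(u in `[0%R, +oo[) (u ^+ 2 * w u)%:E)%E.
  rewrite (@cvg_shiftS _ (fun n => \int[lebesgue_measure]_(u in `[0%R, n%:R]) (u ^+ 2 * w u)%:E)%E).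
  apply: ge0_cvgn_integral; first by move=> x; rewrite mulr_ge0 ?sqr_ge0 ?student_kernel_ge0.
  exact: continuous_measurable_fun.
rewrite -(cvg_lim _ lim1)//; apply/esym/cvg_lim => //.
rewrite (_ : (fun n => _) = fun n => (F n.+1%:R)%:E + (nu - 2)%:E *
   \int[lebesgue_measure]_(u in `[0%R, n.+1%:R]) (u ^+ 2 * w u)%:E)%E; last first.
  by apply/funext => n; exact: Fn.
rewrite -[X in _ --> X]add0e; apply: cvgeD.
- by rewrite fin_num_adde_defr.
- by apply: cvg_EFin => //; exact: nearW.
- exact: cvgeZl.
Qed.

(** * The total mass through the Gamma function *)

(** The integrand of the Gamma function extended by 0 to the whole line, where
    the change of variables and Tonelli's theorem are stated. *)
Definition gamma_kernel (R : realType) (b r : R) : R :=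
  if 0 < r then r `^ (b - 1) * expR (- r) else 0.

Section gamma.
Context {R : realType}.
Implicit Types b r u nu : R.

Lemma gamma_kernel_ge0 b r : 0 <= gamma_kernel b r.
Proof. by rewrite /gamma_kernel; case: ifP => // _; rewrite mulr_ge0 ?powR_ge0 ?expR_ge0. Qed.

Lemma measurable_gamma_kernel b : measurable_fun setT (gamma_kernel b).
Proof.
apply: measurable_fun_ifT => //; first exact: measurable_fun_ltr.
apply: measurable_funM; first exact: measurable_powR.
by apply: measurableT_comp => //.
Qed.

Lemma Gamma_kernelE b :
  Gamma b = (\int[lebesgue_measure]_r gamma_kernel b r).
Proof.
rewrite /Gamma /Rintegral; congr fine; rewrite integral_mkcond.
apply: eq_integral => r _; rewrite /gamma_kernel patchE/=.
rewrite mem_setE in_itv/= andbT; by case: ifP.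
Qed.

Lemma integral_gamma_kernelZ b l : 0 < l ->
  (\int[lebesgue_measure]_r (gamma_kernel b (l * r))%:E =
   l^-1%:E * \int[lebesgue_measure]_r (gamma_kernel b r)%:E)%E.
Proof.
move=> l0; have mg : measurable_fun setT (fun r => (gamma_kernel b r)%:E).
  by apply/measurable_EFinP; exact: measurable_gamma_kernel.
have g0 r : (0 <= (gamma_kernel b r)%:E)%E by rewrite lee_fin gamma_kernel_ge0.
rewrite [in RHS](ge0_integral_rescale l0 mg g0).
by rewrite muleA -EFinM mulVf ?lt0r_neq0// mul1e.
Qed.

Lemma integral_gauss_scaled r : 0 < r ->
  (\int[lebesgue_measure]_u (expR (- (r * u ^+ 2)))%:E =
   (Num.sqrt pi * r `^ (- 2^-1))%:E)%E.
Proof.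
move=> r0; have s0 : 0 < Num.sqrt r by rewrite sqrtr_gt0.
have mg : measurable_fun setT (fun u : R => (gauss_fun u)%:E).
  by apply/measurable_EFinP; exact: measurable_gauss_fun.
have g0 u : (0 <= (gauss_fun u : R)%:E)%E by rewrite lee_fin gauss_fun_ge0.
have := ge0_integral_rescale s0 mg g0; rewrite integralT_gauss.
move=> /(congr1 (fun z => (Num.sqrt r)^-1%:E * z)%E).
rewrite -EFinM [RHS]muleA -[in RHS]EFinM mulVf ?lt0r_neq0// mul1e => gE.
rewrite powRN powR12_sqrt ?ltW// mulrC gE; apply: eq_integral => u _.
by rewrite /gauss_fun exprMn sqr_sqrtr ?ltW.
Qed.

(** Integrate r^(b - 1) exp (- r (1 + u^2)) over r > 0 and real u in both
    orders. Over r first, rescaling gives the kernel (1 + u^2)^(- b); over u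
    first, a Gaussian integral gives a Gamma integrand with b lowered by 1/2. *)
Lemma gamma_student_mass (b : R) :
  (\int[lebesgue_measure]_r (gamma_kernel b r)%:E *
     \int[lebesgue_measure]_u ((1 + u ^+ 2) `^ (- b))%:E =
   (Num.sqrt pi)%:E * \int[lebesgue_measure]_r (gamma_kernel (b - 2^-1) r)%:E)%E.
Proof.
pose K (z : measurableTypeR R * measurableTypeR R) : \bar R :=
  (gamma_kernel b z.2 * expR (- (z.2 * z.1 ^+ 2)))%:E.
have K0 z : (0 <= K z)%E by rewrite lee_fin mulr_ge0 ?gamma_kernel_ge0 ?expR_ge0.
have mK : measurable_fun setT K.
  apply/measurable_EFinP; apply: measurable_funM.
    exact: (measurableT_comp (measurable_gamma_kernel b)).
  apply: (measurableT_comp (@measurable_expR R)); apply: measurable_funN.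
  apply: measurable_funM => //.
  exact: (measurable_funX 2 measurable_fst).
have mG : measurable_fun setT (EFin \o @gamma_kernel R b).
  by apply/measurable_EFinP; exact: measurable_gamma_kernel.
have G0 : (0 <= \int[lebesgue_measure]_r (gamma_kernel b r)%:E)%E.
  by apply: integral_ge0 => r _; rewrite lee_fin gamma_kernel_ge0.
transitivity (\int[lebesgue_measure]_u \int[lebesgue_measure]_r K (u, r))%E.
  rewrite -ge0_integralZl//; last 2 first.
  - apply/measurable_EFinP; apply: measurable_fun_powR.
    exact: measurable_funD.
  - by move=> u _; rewrite lee_fin powR_ge0.
  apply: eq_integral => u _.
  have B0 : 0 < 1 + u ^+ 2 by rewrite ltr_pwDl// sqr_ge0.
  transitivity (\int[lebesgue_measure]_r (((1 + u ^+ 2) `^ (1 - b))%:E *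
      (gamma_kernel b ((1 + u ^+ 2) * r))%:E))%E.
    rewrite ge0_integralZl_EFin//; last 3 first.
    - by move=> r _; rewrite lee_fin gamma_kernel_ge0.
    - apply/measurable_EFinP; apply: (measurableT_comp (measurable_gamma_kernel b)).
      exact: measurable_funM.
    - exact: powR_ge0.
    rewrite integral_gamma_kernelZ// muleA -EFinM muleC; congr (_%:E * _)%E.
    rewrite -[in RHS](powR_inv1 (ltW B0)) -powRD; last by apply/implyP => _; rewrite gt_eqF.
    by congr (_ `^ _); ring.
  apply: eq_integral => r _; rewrite /K -EFinM/=; congr EFin.
  rewrite /gamma_kernel pmulr_rgt0//; case: ifPn => [r0|_]; last by rewrite mulr0 mul0r.
  rewrite powRM ?ltW// mulrA mulrA -powRD; last by apply/implyP => _; rewrite gt_eqF.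
  rewrite (_ : 1 - b + (b - 1) = 0); last by ring.
  rewrite powRr0 mul1r -mulrA -expRD; congr (_ * expR _); ring.
rewrite (fubini_tonelli K)// -ge0_integralZl//; last 2 first.
- by apply/measurable_EFinP; exact: measurable_gamma_kernel.
- by move=> r _; rewrite lee_fin gamma_kernel_ge0.
apply: eq_integral => r _; rewrite /K/=.
under eq_integral do rewrite EFinM.
rewrite ge0_integralZl_EFin//; last 2 first.
- apply/measurable_EFinP; apply: (measurableT_comp (@measurable_expR R)).
  by apply: measurable_funN; apply: measurable_funM.
- exact: gamma_kernel_ge0.
rewrite /gamma_kernel; case: ifPn => [r0|_]; last by rewrite mul0e mule0.
rewrite integral_gauss_scaled// -!EFinM; congr EFin.
have -> : b - 2^-1 - 1 = b - 1 + - 2^-1 by ring.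
rewrite [in RHS]powRD; last by apply/implyP => _; rewrite gt_eqF.
by ring.
Qed.

(** Concavity of the logarithm: ln (1 + r) lies below its tangent at the point
    where 1 + r = p. *)
Lemma expR_ge_powR (p r : R) : 0 < p -> 0 <= r ->
  (1 + r) `^ p <= expR (1 - p + p * ln p) * expR r.
Proof.
move=> p0 r0; have B0 : 0 < 1 + r by rewrite ltr_pwDl.
rewrite -expRD /powR gt_eqF// ler_expR.
have : ln (1 + ((1 + r) / p - 1)) <= (1 + r) / p - 1.
  by apply: le_ln1Dx; rewrite -subr_gt0 opprK subrK divr_gt0.
rewrite addrC subrK ln_div ?posrE// => /(ler_wpM2l (ltW p0)).
rewrite mulrBr (mulrBr _ ((1 + r) / p)) mulrCA divff ?lt0r_neq0// !mulr1.
by lra.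
Qed.

(** An exponential beats any power, so the integrand is at most a multiple of
    the Student kernel, whose integral is finite by assumption. *)
Lemma integral_gamma_kernel_lty nu b : 0 < nu -> 1 <= b ->
  (\int[lebesgue_measure]_u (student_kernel nu u)%:E < +oo)%E ->
  (\int[lebesgue_measure]_r (gamma_kernel b r)%:E < +oo)%E.
Proof.
move=> nu0 b1 Woo.
pose q := (nu + 1) / 2; pose p := b - 1 + 2 * q.
have q0 : 0 < q by rewrite divr_gt0// addr_gt0.
have p0 : 0 < p by rewrite ltr_wpDl ?subr_ge0// mulr_gt0.
pose C := expR (1 - p + p * ln p).
apply: (@le_lt_trans _ _ (\int[lebesgue_measure]_r (C%:E * (student_kernel nu r)%:E)))%E.
  apply: ge0_le_integral => //.
  - by move=> r _; rewrite lee_fin gamma_kernel_ge0.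
  - by apply/measurable_EFinP; exact: measurable_gamma_kernel.
  - apply/measurable_EFinP; apply: measurable_funM => //.
    exact: measurable_student_kernel.
  move=> r _; rewrite -EFinM lee_fin /gamma_kernel.
  case: ifPn => [r0|_]; last by rewrite mulr_ge0 ?expR_ge0 ?student_kernel_ge0.
  have B0 : 0 < 1 + r by rewrite addr_gt0.
  have D0 : 0 < 1 + r ^+ 2 by rewrite ltr_pwDl// sqr_ge0.
  rewrite /student_kernel -/q powRN ler_pdivlMr ?powR_gt0//.
  rewrite expRN mulrAC ler_pdivrMr ?expR_gt0//.
  apply: le_trans (expR_ge_powR p0 (ltW r0)).
  have -> : (1 + r) `^ p = (1 + r) `^ (b - 1) * ((1 + r) ^+ 2) `^ q.
    rewrite -(powR_mulrn 2 (ltW B0)) -powRrM -powRD//.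
    by apply/implyP => _; rewrite gt_eqF.
  apply: ler_pM; rewrite ?powR_ge0//.
    by apply: ge0_ler_powR; rewrite ?nnegrE ?subr_ge0 ?(ltW r0) ?(ltW B0) ?lerDr.
  apply: ge0_ler_powR; rewrite ?nnegrE ?sqr_ge0 ?(ltW D0) ?(ltW q0)//.
  by nra.
rewrite ge0_integralZl_EFin//; last 3 first.
- by move=> r _; rewrite lee_fin student_kernel_ge0.
- by apply/measurable_EFinP; exact: measurable_student_kernel.
- exact: expR_ge0.
by rewrite lte_mul_pinfty ?lee_fin ?expR_ge0.
Qed.

(** The integrand is at least exp (- 2) on [1, 2]. *)
Lemma integral_gamma_kernel_gt0 b : 1 <= b ->
  (0 < \int[lebesgue_measure]_r (gamma_kernel b r)%:E)%E.
Proof.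
move=> b1; pose I : set R := `[1, 2]%classic.
have mI' : measurable_fun setT (\1_I : _ -> R).
  by apply: measurable_indic; rewrite /I.
have I1 : lebesgue_measure I = 1%:E.
  rewrite /I lebesgue_measure_itv/= lte_fin ltr1n -EFinD; congr EFin; ring.
have I0 r : (0 <= (\1_I r : R)%:E)%E by rewrite lee_fin.
have mI : measurable_fun setT (fun r => (\1_I r : R)%:E).
  exact/measurable_EFinP.
apply: (@lt_le_trans _ _ (\int[lebesgue_measure]_r ((expR (- 2))%:E * (\1_I r)%:E)))%E.
  have -> := ge0_integralZl_EFin lebesgue_measure measurableT (fun r _ => I0 r) mI
    (expR_ge0 (- 2)).
  rewrite (integral_indic _ measurableT); last by rewrite /I.
  rewrite setIT [X in (_ * X)%E](_ : _ = 1%:E); last exact: I1.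
  by rewrite -EFinM lte_fin mulr1 expR_gt0.
apply: ge0_le_integral => //.
- by apply/measurable_EFinP; exact: measurable_funM.
- by apply/measurable_EFinP; exact: measurable_gamma_kernel.
move=> r _; rewrite -EFinM lee_fin indicE mem_setE in_itv/=.
have [/andP[r1 r2]|_] := boolP (1 <= r <= 2); last by rewrite mulr0 gamma_kernel_ge0.
rewrite mulr1 /gamma_kernel (lt_le_trans ltr01 r1).
apply: (@le_trans _ _ (expR (- r))); first by rewrite ler_expR lerN2.
rewrite ler_peMl ?expR_ge0// -[leLHS](powRr0 r) ler_powR//.
by rewrite subr_ge0.
Qed.

(** The Gamma integral at (nu + 1) / 2 > 1 is finite and positive; the product
    formula then gives the same for the Gamma integral at nu / 2. *)
Lemma student_kernel_massE nu (W : R) : 1 < nu ->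
  (\int[lebesgue_measure]_u (student_kernel nu u)%:E = W%:E)%E -> 0 < W ->
  W^-1 = Gamma ((nu + 1) / 2) / (Num.sqrt pi * Gamma (nu / 2)).
Proof.
move=> nu1 WE W0; have := gamma_student_mass ((nu + 1) / 2); rewrite WE.
have -> : (nu + 1) / 2 - 2^-1 = nu / 2 by field.
have b1 : 1 <= (nu + 1) / 2 by lra.
have nu0 : 0 < nu by lra.
have := integral_gamma_kernel_lty nu0 b1; rewrite WE ltry => /(_ isT).
have := integral_gamma_kernel_gt0 b1.
have : (0 <= \int[lebesgue_measure]_r (gamma_kernel (nu / 2) r)%:E)%E.
  by apply: integral_ge0 => r _; rewrite lee_fin gamma_kernel_ge0.
have spi : 0 < Num.sqrt (pi : R) by rewrite sqrtr_gt0 pi_gt0.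
rewrite !Gamma_kernelE /Rintegral.
case: (\int[lebesgue_measure]_r (gamma_kernel ((nu + 1) / 2) r)%:E)%E => // G.
case: (\int[lebesgue_measure]_r (gamma_kernel (nu / 2) r)%:E)%E => [G'| |//] _.
  rewrite lte_fin => G0 _; rewrite -!EFinM => -[<-] /=.
  by rewrite invfM mulrA divff ?lt0r_neq0// mul1r.
by rewrite gt0_muley// -EFinM.
Qed.

End gamma.

(** * Moments of the linear forms of a Student vector *)

Section student_moments.
Context {R : realType} {d : measure_display} {T : measurableType d}.
Context (P : probability T R) {n : nat} (mu : 'cV[R]_n.+1).
Context (Sigma : 'M[R]_n.+1) (nu : R) (nu1 : 1 < nu).
Context (X : {RV P >-> n.+1.-tuple R}).
Hypothesis ecX : elliptical X mu Sigma (student_generator nu n.+1).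

Let nu0 : 0 < nu. Proof. by rewrite (lt_trans ltr01). Qed.

Let SS : Sigma^T = Sigma := ecX.1.1.

Local Notation dev a t := (linform a (vec_of (X t) - mu)).

Let measurable_dev a : measurable_fun setT (fun t => dev a t).
Proof.
under eq_fun do rewrite linformB; apply: measurable_funB => //.
by apply: measurable_linform; exact: measurable_funPT.
Qed.

(** The mean absolute value of a Student variable with nu degrees of freedom. *)
Definition student_mean_abs : R :=
  2 * Num.sqrt nu * Gamma ((nu + 1) / 2) /
    ((nu - 1) * (Num.sqrt pi * Gamma (nu / 2))).

Let measurable_weight (h : R -> R) : measurable_fun setT h ->
  measurable_fun setT (fun u => (h u * student_kernel nu u)%:E).
Proof.
move=> mh; apply/measurable_EFinP; apply: measurable_funM => //.
exact: measurable_student_kernel.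
Qed.

Lemma student_mean_abs_linform a :
  (\int[P]_t `|dev a t|%:E =
   (student_mean_abs * Num.sqrt (quadform Sigma a))%:E)%E.
Proof.
have [W W0 WE] := student_kernel_mass nu0 ecX.
have mh : measurable_fun setT (fun y : R => `|y|%:E).
  by apply/measurable_EFinP; exact: normr_measurable.
have h0 (y : R) : (0 <= `|y|%:E)%E by rewrite lee_fin.
rewrite (student_linform nu0 ecX a mh h0) /Rintegral WE.
set r := Num.sqrt (nu * _).
transitivity (W^-1%:E * \int[lebesgue_measure]_u
    (r%:E * (`|u| * student_kernel nu u)%:E))%E.
  congr (_ * _)%E; apply: eq_integral => u _.
  by rewrite -!EFinM normrM mulrA ger0_norm ?sqrtr_ge0.
have f0 u : (0 <= (`|u| * student_kernel nu u)%:E)%E.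
  by rewrite lee_fin mulr_ge0 ?student_kernel_ge0.
have -> := ge0_integralZl_EFin lebesgue_measure measurableT (fun u _ => f0 u)
  (measurable_weight (@normr_measurable R setT)) (sqrtr_ge0 _).
rewrite student_first_moment// -!EFinM; congr EFin.
rewrite (student_kernel_massE nu1 WE W0) /student_mean_abs /r sqrtrM ?ltW//.
rewrite !invfM; ring.
Qed.

Lemma student_mean_sqr_linform a : 2 < nu ->
  (\int[P]_t (dev a t ^+ 2)%:E = (nu / (nu - 2) * quadform Sigma a)%:E)%E.
Proof.
move=> nu2; have [W W0 WE] := student_kernel_mass nu0 ecX.
have mh : measurable_fun setT (fun y : R => (y ^+ 2)%:E).
  by apply/measurable_EFinP; exact: measurable_funX.
have h0 (y : R) : (0 <= (y ^+ 2)%:E)%E by rewrite lee_fin sqr_ge0.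
rewrite (student_linform nu0 ecX a mh h0) /Rintegral WE.
have qa : 0 <= quadform Sigma a.
  have [->|a0] := eqVneq a 0; last by apply/ltW; exact: (ecX.1.2 a a0).
  by rewrite quadformE mulmx0 /linform mulmx0 mxE lexx.
transitivity (W^-1%:E * \int[lebesgue_measure]_u
    ((nu * quadform Sigma a)%:E * (u ^+ 2 * student_kernel nu u)%:E))%E.
  congr (_ * _)%E; apply: eq_integral => u _.
  rewrite -!EFinM exprMn sqr_sqrtr ?mulr_ge0 ?(ltW nu0)//.
  by rewrite -mulrA.
have f0 u : (0 <= (u ^+ 2 * student_kernel nu u)%:E)%E.
  by rewrite lee_fin mulr_ge0 ?sqr_ge0 ?student_kernel_ge0.
have -> := ge0_integralZl_EFin lebesgue_measure measurableT (fun u _ => f0 u)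
  (measurable_weight (measurable_funX 2 (@measurable_id _ _ setT)))
  (mulr_ge0 (ltW nu0) qa).
have := student_second_moment nu2; rewrite WE.
have nu20 : 0 < nu - 2 by rewrite subr_gt0.
have : (0 <= \int[lebesgue_measure]_u (u ^+ 2 * student_kernel nu u)%:E)%E.
  exact: integral_ge0.
case: (\int[lebesgue_measure]_u (u ^+ 2 * student_kernel nu u)%:E)%E => // [M _|_].
  rewrite -!EFinM => -[WM]; congr EFin.
  have M0 : M != 0 by apply: contraTneq W0 => M0; rewrite -WM M0 mulr0 ltxx.
  by rewrite -WM; field; rewrite M0 lt0r_neq0.
by rewrite gt0_muley.
Qed.

(** The law of a linear form depends on a only through a quadratic form, which
    takes the same value at - a. *)
Lemma integral_linformN (a : 'cV[R]_n.+1) (h : R -> \bar R) :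
  measurable_fun setT h -> (forall y, 0 <= h y)%E ->
  (\int[P]_t h (- dev a t)%R = \int[P]_t h (dev a t))%E.
Proof.
move=> mh h0; have -> : (\int[P]_t h (- dev a t)%R = \int[P]_t h (dev (- a) t))%E.
  by apply: eq_integral => t _; rewrite linformNl.
by rewrite !(student_linform nu0 ecX _ mh h0) quadformN.
Qed.

Lemma integrable_linform a : P.-integrable setT (fun t => (dev a t)%:E).
Proof.
apply/integrableP; split; first exact/measurable_EFinP.
by rewrite student_mean_abs_linform ltry.
Qed.

Lemma student_mean_linform a : (\int[P]_t (dev a t)%:E = 0)%E.
Proof.
rewrite integralE.
have -> : (\int[P]_t (fun t => (dev a t)%:E)^\- t =
    \int[P]_t (fun t => (dev a t)%:E)^\+ t)%E.
  transitivity (\int[P]_t maxe (- dev a t)%:E 0)%E.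
    by apply: eq_integral => t _; rewrite funenegE.
  transitivity (\int[P]_t maxe (dev a t)%:E 0)%E; last first.
    by apply: eq_integral => t _; rewrite funeposE.
  apply: (@integral_linformN a (fun y => maxe y%:E 0%E)).
    by apply: measurable_maxe => //; exact/measurable_EFinP.
  by move=> y; rewrite le_max lexx orbT.
rewrite subee//; apply: integrable_pos_fin_num => //.
exact: integrable_linform.
Qed.

Lemma integrable_sqr_linform a : 2 < nu ->
  P.-integrable setT (fun t => (dev a t ^+ 2)%:E).
Proof.
move=> nu2; apply/integrableP; split.
  by apply/measurable_EFinP; exact: measurable_funX.
under eq_integral => t _ do rewrite /= ger0_norm ?sqr_ge0//.
by rewrite student_mean_sqr_linform// ltry.
Qed.

(** Polarisation: the product of two forms is the difference of the squares of
    their half-sum and half-difference, which are again linear forms. *)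
Lemma student_mean_mul_linform a b : 2 < nu ->
  (\int[P]_t (dev a t * dev b t)%:E =
   (nu / (nu - 2) * linform a (Sigma *m b))%:E)%E.
Proof.
move=> nu2; pose s := 2^-1 *: (a + b); pose m := 2^-1 *: (a - b).
have devsm t : dev a t * dev b t = dev s t ^+ 2 - dev m t ^+ 2.
  rewrite /s /m; set v := vec_of _ - mu.
  rewrite ![linform (_ *: _) v]linformC !linformZ linformD linformB.
  by rewrite ![linform v _]linformC; field.
transitivity (\int[P]_t ((dev s t ^+ 2)%:E - (dev m t ^+ 2)%:E))%E.
  by apply: eq_integral => t _; rewrite devsm EFinB.
rewrite integralB//; [|exact: integrable_sqr_linform..].
rewrite !student_mean_sqr_linform// -EFinB; congr EFin.
rewrite /s /m !quadformZ !quadformD// quadformN.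
rewrite -[- b]scaleN1r -scalemxAr linformZ.
by field; rewrite subr_eq0 gt_eqF.
Qed.

End student_moments.

(** * Exchangeable Student vectors *)

Section exchangeability.
Context {R : realType} {d : measure_display} {T : measurableType d}.
Context (P : probability T R) {n : nat} (X : {RV P >-> n.-tuple R}).

Lemma measurable_component i : measurable_fun setT (component X i).
Proof. exact: (measurableT_comp (measurable_tnth i) (measurable_funPT X)). Qed.

(** Exchange the coordinates i and j by a transposition. *)
Lemma exchangeable_component (h : R -> \bar R) (i j : 'I_n) :
  exchangeable X -> measurable_fun setT h -> (forall y, 0 <= h y)%E ->
  (\int[P]_t h (component X i t) = \int[P]_t h (component X j t))%E.
Proof.
move=> exX mh h0; pose s := tperm i j.
pose pX (t : T) : n.-tuple R := [tuple tnth (X t) (s k) | k < n].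
have mpX : measurable_fun setT pX.
  apply/measurable_fun_tnthP => k; rewrite /comp.
  under eq_fun do rewrite tnth_mktuple; exact: measurable_component.
pose f (x : n.-tuple R) := h (tnth x i).
have mf : measurable_fun setT f.
  by apply: (measurableT_comp mh); exact: measurable_tnth.
transitivity (\int[pushforward P X]_x f x)%E.
  by rewrite ge0_integral_pushforward//; move=> x _; exact: h0.
transitivity (\int[pushforward P pX]_x f x)%E.
  by apply: eq_measure_integral => A mA _; exact: exX.
rewrite ge0_integral_pushforward//; last by move=> x _; exact: h0.
by apply: eq_integral => t _; rewrite /= /f tnth_mktuple tpermL.
Qed.

Lemma exchangeable_expectation (i j : 'I_n) :
  exchangeable X -> ('E_P[component X i] = 'E_P[component X j])%E.
Proof.
move=> exX; rewrite !unlock integralE [RHS]integralE; congr (_ - _)%E.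
- under eq_integral do rewrite funeposE.
  under [RHS]eq_integral do rewrite funeposE.
  apply: (@exchangeable_component (fun y => maxe y%:E 0%E)) => //.
    by apply: measurable_maxe => //; exact/measurable_EFinP.
  by move=> y; rewrite le_max lexx orbT.
- under eq_integral do rewrite funenegE.
  under [RHS]eq_integral do rewrite funenegE.
  apply: (@exchangeable_component (fun y => maxe (- y)%:E 0%E)) => //.
    by apply: measurable_maxe => //; apply/measurable_EFinP; exact: measurable_funN.
  by move=> y; rewrite le_max lexx orbT.
Qed.

End exchangeability.

Section student_components.
Context {R : realType} {d : measure_display} {T : measurableType d}.
Context (P : probability T R) {n : nat} (mu : 'cV[R]_n.+1).
Context (Sigma : 'M[R]_n.+1) (nu : R) (nu1 : 1 < nu).
Context (X : {RV P >-> n.+1.-tuple R}).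
Hypothesis ecX : elliptical X mu Sigma (student_generator nu n.+1).

Lemma component_linform i t :
  component X i t = linform (delta_mx i 0) (vec_of (X t) - mu) + mu i 0.
Proof. by rewrite linform_delta !mxE subrK. Qed.

Lemma student_expectation i : ('E_P[component X i] = (mu i 0)%:E)%E.
Proof.
rewrite unlock; transitivity (\int[P]_t
  ((linform (delta_mx i 0) (vec_of (X t) - mu))%:E + (mu i 0)%:E))%E.
  by apply: eq_integral => t _; rewrite component_linform EFinD.
rewrite integralD//; first last.
- exact: finite_measure_integrable_cst.
- exact: (integrable_linform nu1 ecX).
rewrite (student_mean_linform nu1 ecX) add0e.
rewrite (integral_cst P measurableT) -[RHS]mule1; congr (_ * _)%E.
exact: probability_setT.
Qed.

Lemma student_covariance i j : 2 < nu ->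
  covariance P (component X i) (component X j) =
  (nu / (nu - 2) * Sigma i j)%:E.
Proof.
move=> nu2; rewrite unlock !student_expectation/= unlock.
rewrite -linform_mul_delta -(student_mean_mul_linform nu1 ecX)//.
apply: eq_integral => t _; congr EFin.
rewrite -[LHS]/((component X i t - mu i 0) * (component X j t - mu j 0)).
by rewrite !component_linform !addrK.
Qed.

Lemma student_mean_abs_gt0 : 0 < student_mean_abs nu.
Proof.
have [W W0 WE] := student_kernel_mass (lt_trans ltr01 nu1) ecX.
have -> : student_mean_abs nu = 2 * Num.sqrt nu / (nu - 1) * W^-1.
  by rewrite (student_kernel_massE nu1 WE W0) /student_mean_abs !invfM; ring.
by rewrite !mulr_gt0 ?invr_gt0 ?subr_gt0 ?sqrtr_gt0 ?(lt_trans ltr01 nu1).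
Qed.

Hypothesis exX : exchangeable X.

Lemma exchangeable_location i j : mu i 0 = mu j 0.
Proof.
apply: EFin_inj; rewrite -!student_expectation.
exact: exchangeable_expectation.
Qed.

(** All coordinates have the same mean absolute deviation from their common
    mean, and this deviation determines the diagonal entry of the scale
    matrix. *)
Lemma exchangeable_scale i j : Sigma i i = Sigma j j.
Proof.
have Sgt0 k : 0 < Sigma k k by exact: posdef_diag_gt0 ecX.1.
have absE k : (\int[P]_t `|component X k t - mu i 0|%:E =
    (student_mean_abs nu * Num.sqrt (Sigma k k))%:E)%E.
  rewrite -quadform_delta -(student_mean_abs_linform nu1 ecX).
  apply: eq_integral => t _.
  by rewrite component_linform (exchangeable_location k i) addrK.
have : (\int[P]_t `|component X i t - mu i 0|%:E =
    \int[P]_t `|component X j t - mu i 0|%:E)%E.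
  apply: (exchangeable_component (h := fun y => `|y - mu i 0|%:E)) => //.
  by apply/measurable_EFinP; apply: measurableT_comp => //; exact: measurable_funB.
rewrite !absE => -[/(mulfI (lt0r_neq0 student_mean_abs_gt0))].
move=> /(congr1 (fun x => x ^+ 2)).
by rewrite !sqr_sqrtr ?ltW.
Qed.

(** The difference of two coordinates with equal locations is a linear form of
    the centred vector, and with equal diagonal entries its scale is
    2 Sigma_11 (1 - rho_ij). *)
Lemma student_gini_term i j i1 :
  ('E_P[fun t => `|component X i t - component X j t|%R] =
   (2 / Num.sqrt pi * Num.sqrt (Sigma i1 i1) *
    (Num.sqrt (2 * nu) * Gamma ((nu + 1) / 2) /
      ((nu - 1) * Gamma (nu / 2))) *
    Num.sqrt (1 - scale_corr Sigma i j))%:E)%E.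
Proof.
have S0 : 0 < Sigma i1 i1 by exact: posdef_diag_gt0 ecX.1.
rewrite unlock; transitivity (student_mean_abs nu *
    Num.sqrt (quadform Sigma (delta_mx i 0 - delta_mx j 0)))%:E.
  rewrite -(student_mean_abs_linform nu1 ecX); apply: eq_integral => t _.
  rewrite linformC linformB ![linform (_ - mu) _]linformC.
  rewrite !component_linform (exchangeable_location i j).
  by congr (`|_|%:E); ring.
congr EFin.
have -> : quadform Sigma (delta_mx i 0 - delta_mx j 0) =
    2 * (Sigma i1 i1 * (1 - scale_corr Sigma i j)).
  rewrite quadformD; last exact: ecX.1.1.
  rewrite quadformN !quadform_delta -[- _]scaleN1r -scalemxAr linformZ.
  rewrite linform_mul_delta /scale_corr.
  rewrite (exchangeable_scale i i1) (exchangeable_scale j i1).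
  rewrite -expr2 sqr_sqrtr ?ltW//; field.
  exact: lt0r_neq0.
rewrite sqrtrM// sqrtrM ?ltW// [Num.sqrt (2 * nu)]sqrtrM//.
by rewrite /student_mean_abs !invfM; ring.
Qed.

End student_components.

Unset Implicit Arguments.
Set Strict Implicit.

Theorem proposition5 (R : realType) (d : measure_display)
    (T : measurableType d) (P : probability T R)
    (n : nat) (hn : (2 <= n)%N)
    (mu : 'cV[R]_n) (Sigma : 'M[R]_n) (nu : R) (hnu : 1 < nu)
    (X : {RV P >-> n.-tuple R})
    (hX : elliptical X mu Sigma (student_generator nu n))
    (hexch : exchangeable X) :
  let i1 : 'I_n := Ordinal (ltnW hn) in
  let sigma1 := Num.sqrt (Sigma i1 i1) in
  let rho := scale_corr Sigma in
  [/\ GMD P X =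
        (2 / Num.sqrt pi * sigma1 *
         (Num.sqrt (2 * nu) * Gamma ((nu + 1) / 2) /
            ((nu - 1) * Gamma (nu / 2))) *
         (('C(n, 2))%:R^-1 *
          \sum_(i < n) \sum_(j < n | (i < j)%N) Num.sqrt (1 - rho i j)))%:E,
      ('E_P[component X i1] = (mu i1 0)%:E)%E &
      2 < nu ->
        ('V_P[component X i1] = (nu / (nu - 2) * sigma1 ^+ 2)%:E)%E /\
        forall i j : 'I_n, rho i j = corr P (component X i) (component X j)].
Proof.
case: n hn mu Sigma X hX hexch => [//|n] hn mu Sigma X hX hexch.
move=> i1 sigma1 rho.
have S0 i : 0 < Sigma i i by exact: posdef_diag_gt0 hX.1.
split.
- rewrite /GMD; set K := 2 / _ * _ * _.
  under eq_bigr => i _.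
    under eq_bigr => j _ do rewrite (student_gini_term hnu hX hexch i j i1) -/K.
    rewrite sumEFin; over.
  rewrite sumEFin -EFinM; congr EFin.
  rewrite mulrCA; congr (_ * _); rewrite mulr_sumr; apply: eq_bigr => i _.
  by rewrite mulr_sumr.
- exact: (student_expectation hnu hX).
- move=> nu2; have c0 : 0 < nu / (nu - 2) by rewrite divr_gt0 ?subr_gt0 ?(lt_trans ltr01).
  have VE i : ('V_P[component X i] = (nu / (nu - 2) * Sigma i i)%:E)%E.
    exact: (student_covariance hnu hX).
  split; first by rewrite VE sqr_sqrtr ?ltW.
  move=> i j; rewrite /corr !VE (student_covariance hnu hX _ _ nu2)/=.
  rewrite !(sqrtrM _ (ltW c0)) /rho /scale_corr.
  rewrite [in RHS]mulrACA -expr2 sqr_sqrtr ?ltW// -mulf_div divff ?lt0r_neq0//.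
  by rewrite mul1r.
Qed.
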